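(* There is a constant $c$ such that the following holds for every multi energy game $G=(S_1,S_2,s_{init},E,k,w)$. Let $W>0$ be the maximal absolute weight appearing on an edge and $d$ the branching degree of $G$. Suppose there exists a finite-memory winning strategy for $\mathcal P_1$ (for some initial credit). Then there exists a pure finite-memory winning strategy $\lambda_1^D$ for $\mathcal P_1$ described by a DAG $D$ of depth at most $l=2^{(d-1)\cdot|S|}\cdot(W\cdot|S|+1)^{c\cdot k^2}$ and width at most $L=|S|\cdot(2\cdot l\cdot W+1)^k$. Thus the overall memory needed to win this game is bounded by the single exponential $l\cdot L$.
   Context: A game $G=(S_1,S_2,s_{init},E,k,w)$ consists of finite disjoint sets $S_1,S_2$ of states of player 1 ($\mathcal P_1$) and player 2 ($\mathcal P_2$), $S=S_1\cup S_2$, $s_{init}\in S$, $E\subseteq S\times S$ such that every state has a successor, $k\in\mathbb N$, $w:E\to\mathbb Z^k$. The branching degree is the highest number of outgoing edges of any state. A play is an infinite path $\pi=s_0s_1\dots$ with $s_0=s_{init}$; $\pi(n)=s_0\dots s_n$, $\mathsf{EL}(s_0\dots s_n)=\sum_{i<n}w(s_i,s_{i+1})$. A pure strategy of $\mathcal P_1$ maps finite prefixes ending in $S_1$ to a successor of the last state; it is finite-memory if encoded by a Moore machine $(M,m_0,\alpha_u:M\times S\to M,\alpha_n:M\times S_1\to S)$ with $M$ finite, of memory $|M|$. It is winning if for some initial credit $v_0\in\mathbb N^k$ every consistent play satisfies $v_0+\mathsf{EL}(\pi(n))\in\mathbb N^k$ for all $n\ge0$. DAGs describing strategies: a finite directed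 acyclic graph $D$ with a single root, whose nodes are arranged in levels (root at level 0, edges going from one level to the next), with nodes labeled in $S\times\mathbb Z^k$ such that: the root is labeled $\langle s_{init},(0,\dots,0)\rangle$; a non-leaf labeled $\langle t,u\rangle$ with $t\in S_1$ has exactly one child, labeled $\langle t',u+w(t,t')\rangle$ for some $(t,t')\in E$; a non-leaf labeled $\langle t,u\rangle$ with $t\in S_2$ has exactly one child for each edge $(t,t')\in E$, labeled $\langle t',u+w(t,t')\rangle$; every leaf labeled $\langle t,u\rangle$ has an energy ancestor, i.e. a proper ancestor (a node from which the leaf is reachable) labeled $\langle t,u'\rangle$ with $u'\le u$ componentwise. Such a $D$ describes the following strategy of $\mathcal P_1$: a pebble starts at the root; at a leaf it immediately jumps to the oldest (closest to the root) energy ancestor; at a non-leaf labeled $\langle t,u\rangle$ with $t\in S_2$, it moves to the child corresponding to the successor chosen by $\mathcal P_2$; at a non-leaf with $t\in S_1$ it moves to the unique child $\langle t',\cdot\rangle$ and $\mathcal P_1$ plays $t'$. The depth of $D$ is the index of its last level and its width is the maximal number of nodes on a level. *)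

(* Defs.v *)
From HB Require Import structures.
From mathcomp Require Import all_boot all_order all_algebra.

Set Implicit Arguments.
Unset Strict Implicit.
Unset Printing Implicit Defensive.

Import Order.TTheory GRing.Theory Num.Theory.

Definition vec (k : nat) : Type := {ffun 'I_k -> int}.

Definition vle (k : nat) (u v : vec k) : bool := [forall i, (u i <= v i)%R].

(* The states of player 2 are the complement of [P1].  [weight] is total for
   convenience, but its values outside [edge] are irrelevant. *)
Record game := Game {
  state : finType;
  P1 : {set state};
  init : state;
  edge : rel state;
  edge_total : forall s, exists t, edge s t;
  gdim : nat;
  weight : state -> state -> vec gdim
}.

Definition branching (G : game) : nat :=
  \max_(s : state G) #|[set t | edge s t]|.

Definition max_weight (G : game) : nat :=
  \max_(e : state G * state G | edge e.1 e.2)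
    \max_(i < gdim G) absz (weight e.1 e.2 i).

Section Strategies.
Variable G : game.

Definition is_prefix (h : seq (state G)) : bool :=
  if h is s :: p then (s == init G) && path (@edge G) s p else false.

Definition EL (h : seq (state G)) : vec (gdim G) :=
  (\sum_(e <- zip h (behead h)) weight e.1 e.2)%R.

Definition is_play (p : nat -> state G) : Prop :=
  p 0 = init G /\ forall n, edge (p n) (p n.+1).

Definition play_prefix (p : nat -> state G) (n : nat) : seq (state G) :=
  mkseq p n.+1.

(* Only the values on the prefixes ending in [P1] are relevant. *)
Definition strategy : Type := seq (state G) -> state G.

Definition is_strategy (sigma : strategy) : Prop :=
  forall (h : seq (state G)) (s : state G),
    is_prefix (rcons h s) -> s \in P1 G -> edge s (sigma (rcons h s)).

Definition consistent (sigma : strategy) (p : nat -> state G) : Prop :=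
  forall n, p n \in P1 G -> p n.+1 = sigma (play_prefix p n).

Definition winning (sigma : strategy) : Prop :=
  exists v0 : 'I_(gdim G) -> nat,
    forall p, is_play p -> consistent sigma p ->
    forall n i, (0 <= (v0 i)%:Z + EL (play_prefix p n) i)%R.

Record moore := Moore {
  memory : finType;
  m_init : memory;
  m_update : memory -> state G -> memory;
  m_next : memory -> state G -> state G
}.

(* The memory is updated when a state is left: the move from the last state
   [s] of [h s] uses the memory reached after reading [h] only. *)
Definition encodes (M : moore) (sigma : strategy) : Prop :=
  forall (h : seq (state G)) (s : state G),
    is_prefix (rcons h s) -> s \in P1 G ->
    sigma (rcons h s) = m_next (foldl (@m_update M) (m_init M) h) s.

Definition finite_memory (sigma : strategy) : Prop :=
  exists M : moore, encodes M sigma.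

Record ldag := LDag {
  node : finType;
  droot : node;
  darc : rel node;
  level : node -> nat;
  nstate : node -> state G;
  nenergy : node -> vec (gdim G)
}.

Definition leaf (D : ldag) (x : node D) : bool := [forall y, ~~ darc x y].

Definition energy_ancestor (D : ldag) (x y : node D) : bool :=
  [&& y != x, connect (@darc D) y x, nstate y == nstate x
    & vle (nenergy y) (nenergy x)].

(* Acyclicity follows from [darc_level]. *)
Record strategy_dag (D : ldag) : Prop := StrategyDag {
  root_level : level (droot D) = 0;
  darc_level : forall x y : node D, darc x y -> level y = (level x).+1;
  root_unique : forall x : node D, x != droot D -> exists y, darc y x;
  root_state : nstate (droot D) = init G;
  root_energy : nenergy (droot D) = 0%R;
  darc_label : forall x y : node D, darc x y ->
    edge (nstate x) (nstate y) /\
    nenergy y = (nenergy x + weight (nstate x) (nstate y))%R;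
  child_P1 : forall x : node D, ~~ leaf x -> nstate x \in P1 G ->
    exists! y, darc x y;
  child_P2 : forall x : node D, ~~ leaf x -> nstate x \notin P1 G ->
    forall t, edge (nstate x) t -> exists! y, darc x y /\ nstate y = t;
  leaf_ancestor : forall x : node D, leaf x -> exists y, energy_ancestor x y
}.

Definition depth (D : ldag) : nat := \max_(x : node D) level x.

Definition width (D : ldag) : nat :=
  \max_(i < (depth D).+1) #|[set x : node D | level x == i]|.

(* In a DAG several energy ancestors may share the minimal level; [arg min]
   fixes a choice.  The default [x] is not used when [D] is a
   [strategy_dag] and [x] is a leaf. *)
Definition oldest_energy_ancestor (D : ldag) (x : node D) : node D :=
  if [pick y | energy_ancestor x y] is Some y0
  then [arg min_(y < y0 | energy_ancestor x y) level y] else x.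

Definition settle (D : ldag) (x : node D) : node D :=
  if leaf x then oldest_energy_ancestor x else x.

(* [pebble h x]: after the prefix [h], the pebble lies on [x].  Prefixes in
   which player 1 deviates from the moves given by [D] have no pebble. *)
Inductive pebble (D : ldag) : seq (state G) -> node D -> Prop :=
| pebble_root : pebble [:: init G] (settle (droot D))
| pebble_step (h : seq (state G)) (x y : node D) :
    pebble h x -> darc x y -> pebble (rcons h (nstate y)) (settle y).

Definition described_by (D : ldag) (sigma : strategy) : Prop :=
  forall (h : seq (state G)) (x : node D),
    pebble h x -> nstate x \in P1 G ->
    exists2 y, darc x y & sigma h = nstate y.

End Strategies.

(* Main.v *)
(* A winning strategy cannot be beaten by an announcer in the following
   first-cycle game: the states of the current simple path are pushed on a stack,
   each one labelled by a list of pairwise compatible normals, and every closed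
   cycle has to be nonnegative on the normals in the common prefix of its labels.
   Otherwise a play won by the announcer forever contains, by Dickson's lemma, a
   segment of nonnegative total effect between two equal stacks; all labels of the
   segment then share arbitrarily long prefixes, which is absurd.

   Conversely, a controller announces the normals of the nearly tight facets of
   the zonotope-like body defined by [slack a x >= 0].  A Dirichlet argument gives
   small normals, and a potential argument shows that the sum of the closed
   cycles, truncated from above, stays in a box of size (W|S|+1)^O(k).  By the
   pigeonhole principle every play has a covering after (W|S|+1)^O(k^2) steps, and
   merging the equally labelled nodes of a level of the cut-off tree yields the
   DAG. *)

Require Import Defs.
From mathcomp Require Import all_boot all_order all_algebra.
From mathcomp Require Import zify ring lra.
From Stdlib Require Import Classical ClassicalEpsilon.

Set Implicit Arguments.
Unset Strict Implicit.
Unset Printing Implicit Defensive.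

Import Order.TTheory GRing.Theory Num.Theory.

(** In the losing predicate the label is chosen existentially, so a position that is not losing has
    a legal answer to every label. The controller may therefore announce whatever suits it, and no
    determinacy theorem is invoked. Labels are lists rather than sets because the nearly tight
    normals change along a play: what is announced first is withdrawn last, and a cycle is judged
    only by the announcements in force over the whole of it. The obstacle is that a change of
    announcement leaves outdated labels on the stack, and closing a cycle through them may lower the
    slack of a nearly tight normal. Slack is thus held in reserve: the threshold [theta] pays for a
    full stack of outdated labels each time the protecting prefix of a normal changes, and the
    potential [phi] bounds the number of changes. The dilation [Q] of the zonotope is then taken so
    large that nearly tight normals are pairwise compatible. The box has size [(W|S|+1)^O(k)]
    because every constant is polynomial in [k], [W|S|], the number of cycle effects and the size of
    the normals, each of which obeys such a bound. *)

Lemma leq_count (T : eqType) (p q : pred T) (s : seq T) :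
  {in s, forall y, p y -> q y} -> count p s <= count q s.
Proof.
elim: s => //= y s IH pq; apply: leq_add; last first.
  by apply: IH => z zs; apply: pq; rewrite inE zs orbT.
by have := pq y (mem_head _ _); case: (p y) => // ->.
Qed.

Lemma ltn_count (T : eqType) (p q : pred T) (s : seq T) x :
  {in s, forall y, p y -> q y} -> x \in s -> q x -> ~~ p x ->
  count p s < count q s.
Proof.
move=> pq xs qx px; have /permP e := perm_to_rem xs.
rewrite !e /= qx (negbTE px) add0n add1n ltnS; apply: leq_count => y /mem_rem.
exact: pq.
Qed.

(** * Normals and slack *)

Section Vectors.
Local Open Scope ring_scope.
Variable k : nat.
Implicit Types (a b c u v w x y : vec k) (A B L V : seq (vec k)).

Definition dot a v : int := \sum_(i < k) a i * v i.

Lemma dotC a b : dot a b = dot b a.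
Proof. by apply: eq_bigr => i _; rewrite mulrC. Qed.

Lemma dotDl a b v : dot (a + b) v = dot a v + dot b v.
Proof. by rewrite -big_split; apply: eq_bigr => i _; rewrite ffunE mulrDl. Qed.

Lemma dotDr a v w : dot a (v + w) = dot a v + dot a w.
Proof. by rewrite -big_split; apply: eq_bigr => i _; rewrite ffunE mulrDr. Qed.

Lemma dot0l v : dot 0 v = 0.
Proof. by rewrite /dot big1 // => i _; rewrite ffunE mul0r. Qed.

Lemma dot0r a : dot a 0 = 0.
Proof. by rewrite /dot big1 // => i _; rewrite ffunE mulr0. Qed.

Lemma dotNl a v : dot (- a) v = - dot a v.
Proof. by rewrite /dot -sumrN; apply: eq_bigr => i _; rewrite ffunE mulNr. Qed.

Lemma dotNr a v : dot a (- v) = - dot a v.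
Proof. by rewrite /dot -sumrN; apply: eq_bigr => i _; rewrite ffunE mulrN. Qed.

Lemma dotMnl a v n : dot (a *+ n) v = dot a v *+ n.
Proof. by elim: n => [|n IH]; rewrite ?mulr0n ?dot0l // !mulrS dotDl IH. Qed.

Lemma dotMnB w c (q p : nat) v :
  dot (w *+ q - c *+ p) v = dot w v * q%:Z - dot c v * p%:Z.
Proof.
by rewrite dotDl dotNl !dotMnl -[dot w v *+ q]mulr_natr -[dot c v *+ p]mulr_natr
  !natz.
Qed.

Lemma dot_suml (I : Type) (r : seq I) (F : I -> vec k) v :
  dot (\sum_(j <- r) F j) v = \sum_(j <- r) dot (F j) v.
Proof.
by elim: r => [|j r IH]; rewrite ?big_nil ?dot0l // !big_cons dotDl IH.
Qed.

Definition unitv (i : 'I_k) : vec k := [ffun j => (j == i)%:R].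

Lemma dot_unitv a i : dot a (unitv i) = a i.
Proof.
rewrite /dot (bigD1 i) //= ffunE eqxx mulr1 big1 ?addr0 // => j ji.
by rewrite ffunE (negbTE ji) mulr0.
Qed.

Definition nonneg a := [forall i, 0 <= a i].

Lemma nonnegP a : reflect (forall i, 0 <= a i) (nonneg a).
Proof. exact: forallP. Qed.

Lemma nonnegD a b : nonneg a -> nonneg b -> nonneg (a + b).
Proof.
by move=> /nonnegP a0 /nonnegP b0; apply/nonnegP => i; rewrite ffunE addr_ge0.
Qed.

Lemma dot_ge0 a v : nonneg a -> nonneg v -> 0 <= dot a v.
Proof.
by move=> /nonnegP a0 /nonnegP v0; apply: sumr_ge0 => i _; rewrite mulr_ge0.
Qed.

Lemma normDsame (s t : int) : 0 <= s * t -> `|s + t| = `|s| + `|t|.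
Proof. by move=> h; nia. Qed.

Lemma conformal_sign (s t : int) (p q : nat) : 0 <= s * t ->
  p%:Z * `|t| <= q%:Z * `|s| -> 0 <= (s * q%:Z - t * p%:Z) * t.
Proof.
have [t0|t0|->] := ltrgtP t 0; last by rewrite !mulr0.
- rewrite !nmulr_lge0 // => s0; rewrite ltr0_norm // ler0_norm // => h; lra.
- rewrite !pmulr_lge0 // => s0; rewrite gtr0_norm // ger0_norm // => h; lra.
Qed.

Section Slack.
Variable V : seq (vec k).
Hypothesis unitV : forall i, unitv i \in V.

(* [a] and [b] lie in a common closed cone of the normal fan of the
   zonotope generated by [V]. *)
Definition compat a b := all (fun v => 0 <= dot a v * dot b v) V.

(** For pairwise compatible vectors: [b] lies in the smallest closed cone of the fan that contains
    [A]. *)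
Definition covers A b :=
  all (fun v => (dot b v != 0) ==> has (fun a => dot a v != 0) A) V.

Lemma compatC a b : compat a b = compat b a.
Proof. by apply: eq_all => v; rewrite mulrC. Qed.

Variable Q : nat.

(* [slack a x >= 0] for all nonnegative [a] says that [x] lies in the sum
   of the orthant and the zonotope [Q * \sum_v [-v, v]]. *)
Definition slack a x : int := dot a x + Q%:Z * \sum_(v <- V) `|dot a v|.

Lemma slack0 x : slack 0 x = 0.
Proof.
by rewrite /slack dot0l big1 ?mulr0 // => v _; rewrite dot0l normr0.
Qed.

Lemma slackD a b x : compat a b -> slack (a + b) x = slack a x + slack b x.
Proof.
move=> /allP ab; rewrite /slack dotDl.
have -> : \sum_(v <- V) `|dot (a + b) v| =
   \sum_(v <- V) `|dot a v| + \sum_(v <- V) `|dot b v|.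
  rewrite -big_split; apply: eq_big_seq => v vV /=.
  by rewrite dotDl normDsame // ab.
by ring.
Qed.

Lemma slackMn a n x : slack (a *+ n) x = slack a x *+ n.
Proof.
elim: n => [|n IH]; first by rewrite !mulr0n slack0.
rewrite !mulrS slackD ?IH //; apply/allP => v _.
by rewrite dotMnl mulrnAr mulrn_wge0 // -expr2 sqr_ge0.
Qed.

Lemma slackD_le a b x : slack (a + b) x <= slack a x + slack b x.
Proof.
rewrite /slack dotDl addrACA lerD2l -mulrDr ler_wpM2l // -big_split /=.
by apply: ler_sum => v _; rewrite dotDl ler_normD.
Qed.

Lemma slack_sum_le (I : Type) (r : seq I) (F : I -> vec k) x :
  slack (\sum_(j <- r) F j) x <= \sum_(j <- r) slack (F j) x.
Proof.
elim: r => [|j r IH]; first by rewrite !big_nil slack0.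
by rewrite !big_cons; apply: le_trans (slackD_le _ _ _) _; rewrite lerD2l.
Qed.

Lemma slackDr a x v : slack a (x + v) = slack a x + dot a v.
Proof. by rewrite /slack dotDr; ring. Qed.

(* [U] need only meet the closed face cone of every [w]: subtracting multiples of
   such elements from [w] kills the values [dot w v] one after the other. *)
Lemma slack_ge0_conformal (U : seq (vec k)) x :
  (forall w, nonneg w -> w != 0 -> exists c,
     [/\ c \in U, c != 0 & forall v, v \in V ->
         0 <= dot w v * dot c v /\ (dot w v = 0 -> dot c v = 0)]) ->
  (forall c, c \in U -> 0 <= slack c x) ->
  forall w, nonneg w -> 0 <= slack w x.
Proof.
move=> HU Uge w.
have [n] := ubnP (count (fun v => dot w v != 0) V).
elim: n w => // n IH w; rewrite ltnS => cn w0.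
have [->|wn0] := eqVneq w 0; first by rewrite slack0.
have [c [cU c0 cw]] := HU w w0 wn0.
have [i ci] : exists i, c i != 0.
  apply/existsP; apply: contraNT c0; rewrite negb_exists => /forallP c0.
  by apply/eqP/ffunP => i; rewrite ffunE; apply/eqP; rewrite -[_ == _]negbK.
have Hi : (index (unitv i) V < size V)%N by rewrite index_mem.
(* The least ratio [p / q] is the largest multiple of [c] that can be subtracted from [w] before
   some value changes sign; scaling by [q] keeps [w'] integral. *)
pose f (j : 'I_(size V)) : rat :=
  `|dot w (nth 0 V j)|%:~R / `|dot c (nth 0 V j)|%:~R.
have Pi : dot c (nth 0 V (Ordinal Hi)) != 0.
  by rewrite /= nth_index // dot_unitv.
case: (@arg_minP _ _ _ (Ordinal Hi) (fun j => dot c (nth 0 V j) != 0) f Pi) =>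
  j0 j0c j0min.
set v0 := nth 0 V j0 in j0c.
have v0V : v0 \in V by rewrite mem_nth.
set q := absz (dot c v0); set p := absz (dot w v0).
have q0 : (0 < q)%N by rewrite /q absz_gt0.
have minv v : v \in V -> dot c v != 0 ->
    p%:Z * `|dot c v| <= q%:Z * `|dot w v|.
  move=> vV cv.
  have Hv : (index v V < size V)%N by rewrite index_mem.
  have := j0min (Ordinal Hv); rewrite /f /= nth_index // => /(_ cv).
  rewrite -/v0 ler_pdivlMr ?ltr0z ?normr_gt0 //.
  rewrite mulrAC ler_pdivrMr ?ltr0z ?normr_gt0 // -!intrM ler_int.
  by rewrite /p /q !abszE [in X in X -> _]mulrC [in X in _ <= X -> _]mulrC mulrC
     [`|dot c v0| * _]mulrC.
pose w' := w *+ q - c *+ p.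
have dw' v : dot w' v = dot w v * q%:Z - dot c v * p%:Z.
  exact: dotMnB.
have w'c : compat w' (c *+ p).
  apply/allP => v vV; rewrite dw' dotMnl.
  have [h1 h2] := cw v vV.
  have [->|cv] := eqVneq (dot c v) 0; first by rewrite mul0rn mulr0.
  by rewrite mulrnAr mulrn_wge0 // conformal_sign // minv.
have w'0 : nonneg w'.
  apply/nonnegP => j; have := dw' (unitv j); rewrite !dot_unitv => ->.
  have [h1 h2] := cw _ (unitV j); rewrite !dot_unitv in h1 h2.
  have wj := nonnegP w w0 j.
  have [->|cj] := eqVneq (c j) 0; first by rewrite mul0r subr0 mulr_ge0.
  have := minv _ (unitV j); rewrite !dot_unitv => /(_ cj) h3.
  have := conformal_sign h1 h3.
  have cj0 : 0 < c j.
    rewrite lt_def cj -(pmulr_rge0 _ (_ : 0 < w j)) // lt_def wj andbT.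
    exact: contra_neq cj.
  by rewrite pmulr_lge0.
have lt' : (count (fun v => (dot w' v != 0)) V <
            count (fun v => (dot w v != 0)) V)%N.
  have sub v : v \in V -> dot w' v != 0 -> dot w v != 0.
    move=> vV; rewrite dw'; apply: contraNneq => h.
    by have [_ ->] := cw v vV; rewrite ?h ?mul0r.
  have w'v0 : dot w' v0 = 0.
    rewrite dw' /q /p !abszE; have [h _] := cw _ v0V; move: h j0c.
    move: (dot w v0) (dot c v0) => s t; have [t0|t0|->] := ltrgtP t 0 => //.
    - by rewrite nmulr_lge0 // => s0 _; rewrite ltr0_norm // ler0_norm //; ring.
    - by rewrite pmulr_lge0 // => s0 _; rewrite gtr0_norm // ger0_norm //; ring.
  have wv0 : dot w v0 != 0 by apply: contraNneq j0c => e; have [_ ->] := cw _ v0V.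
  by apply: (ltn_count sub v0V wv0); rewrite w'v0 eqxx.
have wE : slack (w *+ q) x = slack w' x + slack (c *+ p) x.
  by rewrite -slackD // subrK.
have h1 := IH _ (leq_trans lt' cn) w'0.
have h2 : 0 <= slack (c *+ p) x by rewrite slackMn mulrn_wge0 // Uge.
have : 0 <= slack (w *+ q) x by rewrite wE addr_ge0.
by rewrite slackMn pmulrn_lge0.
Qed.

(* Two normals separated by some hyperplane [v^\perp] lose [2Q] in the
   subadditivity of the slack, so they cannot both be nearly tight. *)
Lemma slack_incompat a b x :
  0 <= slack (a + b) x -> ~~ compat a b -> 2%:Z * Q%:Z <= slack a x + slack b x.
Proof.
move=> ab /allPn[v0 v0V]; rewrite -ltNge => hv.
apply: le_trans (_ : slack (a + b) x + 2%:Z * Q%:Z <= _); first by rewrite lerDr.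
have h : \sum_(v <- V) `|dot (a + b) v| + 2%:Z <=
    \sum_(v <- V) `|dot a v| + \sum_(v <- V) `|dot b v|.
  rewrite -big_split (big_rem v0 v0V) [leRHS](big_rem v0 v0V) /= dotDl.
  have : \sum_(v <- rem v0 V) `|dot (a + b) v| <=
      \sum_(v <- rem v0 V) (`|dot a v| + `|dot b v|).
    by apply: ler_sum => v _; rewrite dotDl ler_normD.
  have : `|dot a v0 + dot b v0| + 2%:Z <= `|dot a v0| + `|dot b v0|.
    move: hv; move: (dot a v0) (dot b v0) => s t st; nia.
  lra.
have := ler_wpM2l (_ : 0 <= Q%:Z) h => /(_ isT).
rewrite /slack dotDl !mulrDr; lra.
Qed.

(** Summing one element of [L] for each direction seen by [a] gives [u] with the signs of [a] on
    those directions. As [M] bounds the values of [a], [u *+ M - a] is still compatible with [a],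
    and additivity bounds the slack of [a] by that of [u *+ M]. *)
Lemma slack_covered_le a L (M theta : nat) x :
  (forall w, nonneg w -> 0 <= slack w x) ->
  nonneg a -> (forall v, v \in V -> `|dot a v| <= M%:Z) ->
  {in L, forall l, [/\ nonneg l, compat a l & slack l x <= theta%:Z]} ->
  covers L a -> slack a x <= (M * (size V * theta))%:Z.
Proof.
move=> xge a0 aM HL cov.
pose F v := nth 0 L (find (fun l => dot l v != 0) L).
pose u := \sum_(v <- [seq v <- V | dot a v != 0]) F v.
have FL v : v \in [seq v <- V | dot a v != 0] -> F v \in L /\ dot (F v) v != 0.
  rewrite mem_filter => /andP[av vV].
  have h : has (fun l => dot l v != 0) L by have := allP cov v vV; rewrite av.
  by split; [rewrite mem_nth // -has_find | exact: (nth_find 0 h)].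
have signu v : v \in V ->
    (0 < dot a v -> 1 <= dot u v) /\ (dot a v < 0 -> dot u v <= -1).
  move=> vV; rewrite dot_suml.
  have Fa z : z \in [seq v <- V | dot a v != 0] -> 0 <= dot a v * dot (F z) v.
    by move=> /FL[zL _]; have [_ /allP/(_ v vV)] := HL _ zL.
  have [av|av|//] := ltrgtP (dot a v) 0.
  - have Fa' z : z \in [seq v <- V | dot a v != 0] -> dot (F z) v <= 0.
      by move=> /Fa; rewrite nmulr_rge0.
    have vin : v \in [seq v <- V | dot a v != 0].
      by rewrite mem_filter vV andbT lt_eqF.
    have h : \sum_(z <- [seq v <- V | dot a v != 0]) dot (F z) v <= -1.
      rewrite (big_rem v) //=.
      rewrite -[leRHS]addr0; apply: lerD.
        by have [_] := FL _ vin; have := Fa' _ vin; move: (dot _ _) => s; lia.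
      rewrite big_seq; apply: sumr_le0 => z /mem_rem; exact: Fa'.
    by split.
  - have Fa' z : z \in [seq v <- V | dot a v != 0] -> 0 <= dot (F z) v.
      by move=> /Fa; rewrite pmulr_rge0.
    have vin : v \in [seq v <- V | dot a v != 0].
      by rewrite mem_filter vV andbT gt_eqF.
    have h : 1 <= \sum_(z <- [seq v <- V | dot a v != 0]) dot (F z) v.
      rewrite (big_rem v) //=.
      rewrite -[leLHS]addr0; apply: lerD.
        by have [_] := FL _ vin; have := Fa' _ vin; move: (dot _ _) => s; lia.
      rewrite big_seq; apply: sumr_ge0 => z /mem_rem; exact: Fa'.
    by split.
pose w := u *+ M - a.
have dw v : dot w v = dot u v * M%:Z - dot a v.
  by rewrite /w -[a]mulr1n dotMnB mulr1n mulr1.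
have wa : compat w a.
  apply/allP => v vV; rewrite dw; have [h1 h2] := signu v vV.
  have := aM v vV; have [av|av|->] := ltrgtP (dot a v) 0; last by rewrite mulr0.
  - rewrite nmulr_lge0 // subr_le0 ltr0_norm // => h.
    by have := h2 av; move: h; move: (dot u v) (dot a v) => s t; nia.
  - rewrite pmulr_lge0 // subr_ge0 gtr0_norm // => h.
    by have := h1 av; move: h; move: (dot u v) (dot a v) => s t; nia.
have u0 : nonneg u.
  rewrite /u big_seq; elim/big_ind: _ => [||v /FL[vL _]].
  - by apply/nonnegP => i; rewrite ffunE.
  - exact: nonnegD.
  - by have [] := HL _ vL.
have w0 : nonneg w.
  apply/nonnegP => i; have := dw (unitv i); rewrite !dot_unitv => ->.
  have [h1 _] := signu _ (unitV i); have := aM _ (unitV i).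
  rewrite !dot_unitv in h1 *; have := nonnegP _ a0 i; have := nonnegP _ u0 i.
  rewrite subr_ge0 => u_ a_; rewrite ger0_norm // => h.
  by move: h1 u_ a_ h; move: (u i) (a i) => s t h1 *; have [/h1|] := ltP 0 t; nia.
have e : slack (u *+ M) x = slack w x + slack a x by rewrite -slackD // subrK.
have h1 : slack a x <= slack (u *+ M) x by rewrite e lerDr xge.
apply: le_trans h1 _; rewrite slackMn -mulr_natl natz PoszM ler_wpM2l //.
apply: le_trans (slack_sum_le _ _ _) _.
rewrite big_filter big_seq_cond.
apply: (@le_trans _ _ (\sum_(v <- V | (v \in V) && (dot a v != 0)) theta%:Z)).
  apply: ler_sum => v /andP[vV av].
  by have [] := HL (F v) _ => //; have [] := FL v; rewrite ?mem_filter ?av.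
rewrite -big_seq_cond -big_filter big_const_seq iter_addr_0 count_predT.
by rewrite -mulr_natl natz PoszM ler_wpM2r // lez_nat size_filter count_size.
Qed.

End Slack.

End Vectors.

(** * Limit inferior and Dickson's lemma *)

Section Sequences.

Lemma exists_tail_min (f : nat -> nat) N :
  exists n, N <= n /\ forall m, N <= m -> f n <= f m.
Proof.
apply: NNPP => h.
have {}h n : N <= n -> exists2 m, N <= m & f m < f n.
  move=> Nn; apply: NNPP => h1; apply: h; exists n; split=> // m Nm.
  by rewrite leqNgt; apply/negP => lt; apply: h1; exists m.
suff H c n : N <= n -> f n < c -> False by apply: (H (f N).+1 N).
elim: c n => // c IH n Nn; rewrite ltnS => fc.
by have [m Nm fm] := h n Nn; apply: (IH m Nm); apply: leq_trans fm fc.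
Qed.

(** The tail minima are nondecreasing and bounded, hence eventually constant. *)
Lemma exists_liminf (f : nat -> nat) b : (forall n, f n <= b) ->
  exists i N, (forall n, N <= n -> i <= f n) /\
    forall N', exists n, N' <= n /\ f n = i.
Proof.
move=> fb.
have [g Hg] : exists g : nat -> nat,
    forall N, N <= g N /\ forall m, N <= m -> f (g N) <= f m.
  exists (fun N => proj1_sig (constructive_indefinite_description _
    (exists_tail_min f N))) => N.
  by case: (constructive_indefinite_description _ _).
have mono N N' : N <= N' -> f (g N) <= f (g N').
  by move=> h; apply: (Hg N).2; apply: leq_trans h (Hg N').1.
have [i [N [hi hN]]] : exists i N, f (g N) = i /\ forall N', f (g N') <= i.
  have [N [_ hN]] := exists_tail_min (fun N => b - f (g N)) 0.
  exists (f (g N)), N; split=> // N'.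
  by have := hN N' isT; have := fb (g N); have := fb (g N'); lia.
exists i, N; split; first by move=> n Nn; rewrite -hi; apply: (Hg N).2.
move=> N'; exists (g (maxn N N')); split.
  by apply: leq_trans (Hg _).1; rewrite leq_maxr.
by apply/eqP; rewrite eqn_leq hN -hi mono ?leq_maxl.
Qed.

Definition increasing (phi : nat -> nat) := forall i, phi i < phi i.+1.

Lemma increasing_ltn phi : increasing phi -> {homo phi : i j / i < j}.
Proof. by move=> H; apply: homo_ltn => // ? ? ?; apply: ltn_trans. Qed.

Lemma increasing_choice (P : nat -> Prop) :
  (forall N, exists n, N <= n /\ P n) ->
  exists phi, increasing phi /\ forall i, P (phi i).
Proof.
move=> H; pose g N := proj1_sig (constructive_indefinite_description _ (H N)).
have Hg N : N <= g N /\ P (g N).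
  by rewrite /g; case: (constructive_indefinite_description _ _).
exists (fix phi i := if i is j.+1 then g (phi j).+1 else g 0).
by split=> [i|[|i]] /=; [exact: (Hg _).1 | exact: (Hg _).2 | exact: (Hg _).2].
Qed.

Lemma nondecreasing_subseq (f : nat -> nat) :
  exists phi, increasing phi /\ {homo f \o phi : i j / i <= j}.
Proof.
have [|phi [inc Hphi]] :=
    @increasing_choice (fun n => forall m, n <= m -> f n <= f m).
  move=> N; have [n [Nn Hn]] := exists_tail_min f N; exists n; split=> // m nm.
  by apply: Hn; apply: leq_trans Nn nm.
exists phi; split=> // i j; rewrite leq_eqVlt => /predU1P[->//|ij].
by apply: Hphi; apply/ltnW/increasing_ltn.
Qed.

(** Dickson's lemma, by extracting a subsequence for one coordinate after the other. *)
Lemma nondecreasing_subseqs (I : eqType) (l : seq I) (F : nat -> I -> nat) :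
  exists phi, increasing phi /\
    forall x, x \in l -> {homo (fun n => F (phi n) x) : i j / i <= j}.
Proof.
elim: l => [|x l [phi [inc IH]]]; first by exists id; split=> // i; exact: ltnSn.
have [psi [inc' Hpsi]] := nondecreasing_subseq (fun n => F (phi n) x).
exists (phi \o psi); split=> [i|y] /=; first exact: increasing_ltn.
rewrite inE => /predU1P[->//|yl] i j ij; apply: IH => //.
move: ij; rewrite leq_eqVlt => /predU1P[->//|ij].
exact/ltnW/increasing_ltn.
Qed.

End Sequences.

(** * First-cycle games *)

Section FirstCycle.
Local Open Scope ring_scope.
Variable G : game.
Variable V : seq (vec (gdim G)).
Notation S := (state G).
Notation k := (gdim G).
Notation lab := (seq (vec k)).
Notation stack := (seq (S * lab)).
Implicit Types (L P : lab) (p z c r : stack).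

(* The head of a stack is the most recently left state; [t] is the current one. *)
Fixpoint eff p (t : S) : vec k :=
  if p is e :: r then weight e.1 t + eff r e.1 else 0.

Lemma eff_cat c r t : eff (c ++ r) t = eff c t + eff r (last t (unzip1 c)).
Proof. by elim: c t => [|e c IH] t /=; rewrite ?add0r // IH addrA. Qed.

Definition cycle_of z (s : S) := take (index s (unzip1 z)).+1 z.
Definition rest_of z (s : S) := drop (index s (unzip1 z)).+1 z.

Lemma eff_cycle z s : s \in unzip1 z ->
  eff z s = eff (cycle_of z s) s + eff (rest_of z s) s.
Proof.
move=> sz; rewrite -{1}(cat_take_drop (index s (unzip1 z)).+1 z) eff_cat.
congr (_ + eff _ _); rewrite /unzip1 map_take.
have lt : (index s (unzip1 z) < size (unzip1 z))%N by rewrite index_mem.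
by rewrite (take_nth s lt) nth_index // last_rcons.
Qed.

Definition announceable L := all (@nonneg k) L && all (fun a => all (compat V a) L) L.

(** All common prefixes are tested; the longest one decides. *)
Definition good_cycle c s :=
  forall P, all (fun e => prefix P e.2) c -> {in P, forall a, 0 <= dot a (eff c s)}.

(** The label of [s] is fixed before the move out of [s]. A bad cycle wins for the announcer at
    once; a good one ends the game for player 1, which is why it has no disjunct. *)
Inductive lose p (s : S) : Prop :=
| Lose L of announceable L
  & (s \in P1 G -> forall t, edge s t ->
       (t \in unzip1 ((s, L) :: p) /\ ~ good_cycle (cycle_of ((s, L) :: p) t) t)
       \/ (t \notin unzip1 ((s, L) :: p) /\ lose ((s, L) :: p) t))
  & (s \notin P1 G -> exists2 t, edge s t &
       (t \in unzip1 ((s, L) :: p) /\ ~ good_cycle (cycle_of ((s, L) :: p) t) t)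
       \/ (t \notin unzip1 ((s, L) :: p) /\ lose ((s, L) :: p) t)).

Definition bad_move p (s : S) L (t : S) :=
  (t \in unzip1 ((s, L) :: p) /\ ~ good_cycle (cycle_of ((s, L) :: p) t) t)
  \/ (t \notin unzip1 ((s, L) :: p) /\ lose ((s, L) :: p) t).

Definition losing_label p s L :=
  [/\ announceable L,
     s \in P1 G -> forall t, edge s t -> bad_move p s L t
   & s \notin P1 G -> exists2 t, edge s t & bad_move p s L t].

Lemma loseP p s : lose p s <-> exists L, losing_label p s L.
Proof.
by split=> [[L h1 h2 h3]|[L [h1 h2 h3]]]; [exists L; split | exists L].
Qed.

(** Effect of the simple path when the current state is itself the head of the stack. *)
Definition top_eff z : vec k := if z is e :: r then eff r e.1 else 0.

(* [X t] is the sum of the cycles closed before time [t]: on the prefix shared by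
   all labels it is nonincreasing along the segment, and nonnegative in total,
   hence constant.  The prefix witnessing that a cycle is bad is thus strictly
   longer, which propagates backwards to all labels. *)
Section Segment.
Variables (lam : stack -> S -> lab) (z : nat -> stack) (s : nat -> S).
Variable E : nat -> vec k.
Hypothesis step : forall t, z t.+1 =
  if s t.+1 \in unzip1 (z t) then drop (index (s t.+1) (unzip1 (z t))) (z t)
  else (s t.+1, lam (z t) (s t.+1)) :: z t.
Hypothesis stepE : forall t, E t.+1 - E t = eff (z t) (s t.+1) - top_eff (z t).
Hypothesis z0 : forall t, z t != [::].
Hypothesis announced : forall t, {in z t, forall e, announceable e.2}.
Hypothesis bad : forall t, s t.+1 \in unzip1 (z t) ->
  ~ good_cycle (cycle_of (z t) (s t.+1)) (s t.+1).
Hypothesis effV : forall t, s t.+1 \in unzip1 (z t) ->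
  eff (cycle_of (z t) (s t.+1)) (s t.+1) \in V.
Variables n m : nat.
Hypothesis nm : (n < m)%N.
Hypothesis size_nm : size (z n) = size (z m).
Hypothesis above : forall t, (n <= t <= m)%N -> (size (z n) <= size (z t))%N.
Hypothesis EE : forall i, E n i <= E m i.

Let X t := E t - top_eff (z t).
Let pop t := s t.+1 \in unzip1 (z t).
Let cyc t := cycle_of (z t) (s t.+1).

Let step_pop t : pop t -> X t.+1 - X t = eff (cyc t) (s t.+1).
Proof.
move=> pt; have pt' := pt; rewrite /pop in pt'.
have e : E t.+1 = E t + (eff (z t) (s t.+1) - top_eff (z t)).
  by rewrite -stepE addrC subrK.
rewrite /X e eff_cycle // step pt'.
have lt : (index (s t.+1) (unzip1 (z t)) < size (z t))%N.
  by rewrite -(size_map (@fst _ _)) index_mem.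
rewrite (drop_nth (s t.+1, [::]) lt) /= -(nth_map _ (s t.+1)) // nth_index //.
rewrite -/(rest_of _ _) -/(cyc t).
move: (E t) (eff (cyc t) _) (eff (rest_of _ _) _) (top_eff _) => a b c d.
by apply/ffunP => i; rewrite !ffunE; ring.
Qed.

Let step_push t : ~~ pop t -> X t.+1 = X t.
Proof.
move=> pt; have e : E t.+1 = E t + (eff (z t) (s t.+1) - top_eff (z t)).
  by rewrite -stepE addrC subrK.
rewrite /X e step ifN //=; move: (E t) (eff _ _) (top_eff _) => a b c.
by apply/ffunP => i; rewrite !ffunE; ring.
Qed.

(** No pop of the segment goes below the height of [z n], so [z n] stays at the bottom; equal
    heights then force equal stacks. *)
Let suffix t : (n <= t <= m)%N -> exists r, z t = r ++ z n.
Proof.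
elim: t => [|t IH]; first by rewrite leqn0 => /andP[/eqP-> _]; exists [::].
case/andP; rewrite leq_eqVlt => /predU1P[<- _|]; first by exists [::].
rewrite ltnS => nt tm; have := above (_ : n <= t.+1 <= m)%N.
rewrite tm (ltnW (_ : (n < t.+1)%N)) // step => /(_ isT).
have [|r ->] := IH; first by rewrite nt ltnW.
case: ifP => _ le; last by exists ((s t.+1, lam (r ++ z n) (s t.+1)) :: r).
rewrite drop_cat; case: ltnP => h; first by eexists.
exists [::]; move: le; rewrite drop_cat ltnNge h /= size_drop.
move: (index _ _ - size r)%N => [|j]; first by rewrite drop0.
by have := z0 n; case: (z n) => //= a l _; rewrite subSS; lia.
Qed.

Let zz : z n = z m.
Proof.
have [|r e] := @suffix m; first by rewrite leqnn ltnW.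
have := size_nm; rewrite e size_cat => /eqP; rewrite -{1}[size (z n)]add0n eqn_add2r.
by case: r e.
Qed.

Let lbl t : lab := if z t is e :: _ then e.2 else [::].

Let lblE t : exists x r, z t = (x, lbl t) :: r.
Proof. by rewrite /lbl; have := z0 t; case: (z t) => // -[x L] r _; exists x, r. Qed.

Let bad_pop t : pop t -> exists P a, [/\ all (fun e => prefix P e.2) (cyc t),
  a \in P & dot a (eff (cyc t) (s t.+1)) < 0].
Proof.
move=> /bad h; apply: NNPP => h1; apply: h => P Pc a aP; rewrite leNgt.
by apply/negP => lt; apply: h1; exists P, a.
Qed.

Let lbl_cyc t : pop t -> exists c, cyc t = (head (s t, [::]) (z t)) :: c.
Proof.
move=> _; rewrite /cyc /cycle_of; have := z0 t; case: (z t) => // e r _ /=.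
by eexists.
Qed.

Let lbl_prefix t P : pop t -> all (fun e => prefix P e.2) (cyc t) ->
  prefix P (lbl t).
Proof.
rewrite /lbl => /lbl_cyc[c ->] /= /andP[+ _].
by have := z0 t; case: (z t).
Qed.

Let lbl_announceable t : announceable (lbl t).
Proof.
have [x [r e]] := lblE t; have /(_ (x, lbl t)) := announced (t := t).
by rewrite e mem_head; apply.
Qed.

Let all_take q := forall t, (n <= t < m)%N ->
  (q <= size (lbl t))%N /\ take q (lbl t) = take q (lbl n).

(** A bad cycle is negative on some [b] of the top label. That label also contains [a], and
    compatibility along the cycle effect, a member of [V], excludes a positive value of [a]. *)
Let dX_le0 q t a : all_take q -> (n <= t < m)%N -> a \in take q (lbl n) ->
  dot a (X t.+1) <= dot a (X t).
Proof.
move=> Pq tnm; have [_ <-] := Pq t tnm => /mem_take aL.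
have [pt|pt] := boolP (pop t); last by rewrite step_push.
rewrite -subr_le0 -dotNr -dotDr step_pop //.
have [P [b [Pc bP neg]]] := bad_pop pt.
have bL : b \in lbl t.
  have /prefixP[Y ->] := lbl_prefix pt Pc; by rewrite mem_cat bP.
have /andP[_ /allP/(_ a aL)/allP/(_ b bL)/allP/(_ _ (effV pt))] :=
  lbl_announceable t.
by rewrite nmulr_lge0.
Qed.

(** The values never increase, yet equal stacks turn [X m - X n] into [E m - E n], on which the
    nonnegative [a] is nonnegative. *)
Let dX_eq q t a : all_take q -> (n <= t < m)%N -> a \in take q (lbl n) ->
  dot a (X t.+1) = dot a (X t).
Proof.
move=> Pq tnm aq; apply/eqP; rewrite eq_le (dX_le0 Pq) //=.
have mono i j : (n <= i)%N -> (i <= j)%N -> (j <= m)%N -> dot a (X j) <= dot a (X i).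
  move=> ni; elim: j => [|j IH]; first by rewrite leqn0 => /eqP->.
  rewrite leq_eqVlt => /predU1P[->//|]; rewrite ltnS => ij jm.
  apply: le_trans (IH ij (ltnW jm)); apply: (dX_le0 Pq) => //.
  by rewrite jm (leq_trans ni ij).
case/andP: tnm => nt tm.
apply: le_trans (mono n t (leqnn _) nt (ltnW tm)) _.
apply: le_trans _ (mono t.+1 m (leqW nt) tm (leqnn _)).
rewrite -subr_ge0 -dotNr -dotDr /X zz.
have -> : E m - top_eff (z m) - (E n - top_eff (z m)) = E m - E n.
  by apply/ffunP => i; rewrite !ffunE; ring.
apply: dot_ge0; last by apply/nonnegP => i; rewrite !ffunE subr_ge0.
have /andP[/allP h _] := lbl_announceable n; apply: h; exact: mem_take aq.
Qed.

Let pop_labels q t : all_take q -> (n <= t < m)%N -> pop t ->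
  (q < size (lbl t))%N /\
  {in cyc t, forall e, take q.+1 e.2 = take q.+1 (lbl t)}.
Proof.
move=> Pq tnm pt; have [P [b [Pc bP neg]]] := bad_pop pt.
have qP : (q < size P)%N.
  rewrite ltnNge; apply/negP => Pqs.
  have [qs tq] := Pq t tnm.
  have bq : b \in take q (lbl n).
    rewrite -tq; have /prefixP[Y e] := lbl_prefix pt Pc.
    by rewrite e take_cat ltnNge Pqs /= mem_cat bP.
  have := dX_eq Pq tnm bq => /eqP.
  by rewrite -subr_eq0 -dotNr -dotDr step_pop // lt_eqF.
have tP e : prefix P e -> take q.+1 e = take q.+1 P.
  by move=> /prefixP[Y ->]; rewrite takel_cat.
split; last by move=> e /(allP Pc) /tP ->; rewrite (tP (lbl t)) // (lbl_prefix pt).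
by apply: leq_trans qP _; apply: size_prefix; exact: lbl_prefix Pc.
Qed.

(** Backwards from [m]: the last label of a popped cycle survives as head of the next stack, so
    agreement there extends to the whole cycle. *)
Let labels_eq q t : all_take q -> (n <= t <= m)%N ->
  {in take (size (z t) - size (z n)).+1 (z t),
    forall e, take q.+1 e.2 = take q.+1 (lbl n)}.
Proof.
move=> Pq; have [j] := ubnP (m - t); elim: j t => // j IH t.
rewrite ltnS => mtj /andP[nt]; rewrite leq_eqVlt => /predU1P[->|tm].
  rewrite -zz subnn; have [x [r ->]] := lblE n.
  by move=> e; rewrite /= take0 inE => /eqP->.
have {}IH := IH t.+1; have tnm : (n <= t < m)%N by rewrite nt.
have le1 := above (_ : n <= t.+1 <= m)%N; rewrite tm leqW // in le1.
have {}le1 := le1 isT.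
have {}IH : {in take (size (z t.+1) - size (z n)).+1 (z t.+1),
    forall e, take q.+1 e.2 = take q.+1 (lbl n)}.
  by apply: IH; rewrite ?tm ?leqW // subnS; move: mtj tm; clear; lia.
have [pt|pt] := boolP (pop t); last first.
  move=> e et; apply: IH; move: et; rewrite step ifN // => et.
  have le0 := above (_ : n <= t <= m)%N; rewrite nt ltnW // in le0.
  by rewrite [size _]/= subSn ?le0 //= inE; apply/orP; right.
have [qs cE] := pop_labels Pq tnm pt.
set i := index (s t.+1) (unzip1 (z t)).
have lt : (i < size (z t))%N by rewrite -(size_map (@fst _ _)) index_mem.
have e1 : z t.+1 = drop i (z t) by rewrite step ifT.
have e2 : nth (s t, [::]) (z t) i \in take (size (z t.+1) - size (z n)).+1 (z t.+1).
  by rewrite e1 (drop_nth (s t, [::]) lt) /= mem_head.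
have e3 : nth (s t, [::]) (z t) i \in cyc t.
  rewrite /cyc /cycle_of -/i (take_nth (s t, [::]) lt) mem_rcons mem_head.
  by [].
have base : take q.+1 (lbl t) = take q.+1 (lbl n) by rewrite -(cE _ e3) IH.
move=> e.
have -> : (size (z t) - size (z n)).+1 =
    (i + (size (z t.+1) - size (z n)).+1)%N.
  by rewrite e1 size_drop in le1 *; move: le1 lt; clear; lia.
rewrite takeD mem_cat => /orP[h|]; last by rewrite -e1; exact: IH.
rewrite cE ?base // /cyc /cycle_of -/i.
by rewrite (take_nth (s t, [::]) lt) mem_rcons inE h orbT.
Qed.

Let all_takeS q : all_take q -> all_take q.+1.
Proof.
move=> Pq.
have tE t : (n <= t < m)%N -> take q.+1 (lbl t) = take q.+1 (lbl n).
  move=> /andP[nt tm]; have tnm : (n <= t <= m)%N by rewrite nt ltnW.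
  have [x [r e]] := lblE t; have := labels_eq Pq tnm; rewrite e.
  by move=> /(_ (x, lbl t)) /=; apply; rewrite mem_head.
have m1 : (n <= m.-1 < m)%N by move: nm; clear; lia.
have mE : m.-1.+1 = m by move: nm; clear; lia.
(* A push into time [m] would start from a height below that of [z n], so the last move is a pop. *)
have pm : pop m.-1.
  apply/negPn/negP => pm; have := above (_ : n <= m.-1 <= m)%N.
  case/andP: m1 => -> /ltnW -> /(_ isT); rewrite zz -{1}mE step ifN //=.
  by rewrite ltnn.
have [qm _] := pop_labels Pq m1 pm.
have qn : size (take q.+1 (lbl n)) = q.+1 by rewrite -(tE _ m1) size_takel.
move=> t tnm; split; last exact: tE.
by move: qn; rewrite -(tE t tnm) size_take; case: ltnP => [/ltnW//|_ ->].
Qed.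

Lemma no_recurrent_segment : False.
Proof.
have all q : all_take q.
  by elim: q => [t _|q]; [rewrite !take0 | exact: all_takeS].
have := all (size (lbl n)).+1 n; rewrite leqnn nm => /(_ isT)[].
by rewrite ltnn.
Qed.

End Segment.

End FirstCycle.

(** * Energy levels of histories *)

Section Histories.
Local Open Scope ring_scope.
Variable G : game.
Implicit Types (a b t : state G) (h : seq (state G)).

Lemma EL1 a : EL [:: a] = 0.
Proof. by rewrite /EL /= big_nil. Qed.

Lemma EL_cons a b h : EL (a :: b :: h) = weight a b + EL (b :: h).
Proof. by rewrite /EL /= big_cons. Qed.

Lemma EL_rcons a h t : EL (a :: rcons h t) = EL (a :: h) + weight (last a h) t.
Proof.
elim: h a => [|b h IH] a; last by rewrite rcons_cons !EL_cons IH addrA.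
by rewrite EL_cons !EL1 addr0 add0r.
Qed.

Lemma is_prefix_rcons a h t :
  is_prefix (a :: rcons h t) = is_prefix (a :: h) && edge (last a h) t.
Proof. by rewrite /= rcons_path andbA. Qed.

Lemma is_prefix_split h : is_prefix h -> exists a h', h = a :: h'.
Proof. by case: h => // a h' _; exists a, h'. Qed.

End Histories.

(** * The announcer's play against a winning strategy *)

Section Winning.
Local Open Scope ring_scope.
Variable G : game.
Variable V : seq (vec (gdim G)).
Notation S := (state G).
Notation k := (gdim G).
Notation lab := (seq (vec k)).
Notation stack := (seq (S * lab)).
Notation back := (fun t x : S => edge x t).
Hypothesis effV : forall (c : stack) (s : S), uniq (unzip1 c) ->
  path back s (unzip1 c) -> eff c s \in V.

Variable sigma : strategy G.
Hypothesis sigma_strategy : is_strategy sigma.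
Hypothesis sigma_winning : winning sigma.

Section Refute.
Hypothesis init_loses : lose V [::] (init G).

Let lam (p : stack) (s : S) : lab := epsilon (inhabits [::]) (losing_label V p s).

Let lamP p s : lose V p s -> losing_label V p s (lam p s).
Proof. by move=> /loseP; apply: epsilon_spec. Qed.

Let mu (z : stack) : S := if z is e :: r then
  epsilon (inhabits (init G)) (fun t => edge e.1 t /\ bad_move V r e.1 e.2 t)
  else init G.

Let next (z : stack) (h : seq S) : S :=
  if z is e :: r then if e.1 \in P1 G then sigma h else mu z else init G.

Let move (z : stack) (t : S) : stack :=
  if t \in unzip1 z then drop (index t (unzip1 z)) z else (t, lam z t) :: z.

Fixpoint run (n : nat) : stack * seq S :=
  if n is j.+1 then
    let t := next (run j).1 (run j).2 in (move (run j).1 t, rcons (run j).2 t)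
  else ([:: (init G, lam [::] (init G))], [:: init G]).

(** Recorded for every suffix, so that a pop returns to a losing position with the label chosen
    there. *)
Fixpoint consistent_labels (z : stack) : Prop :=
  if z is e :: r then [/\ e.2 = lam r e.1, lose V r e.1 & consistent_labels r]
  else True.

Let z n := (run n).1.
Let h n := (run n).2.
Let s n := last (init G) (h n).

Let labels_drop i r : consistent_labels r -> consistent_labels (drop i r).
Proof. by elim: r i => [|e r IH] [|i] //= [_ _ /IH]. Qed.

Let inv n := [/\ consistent_labels (z n), uniq (unzip1 (z n)),
  sorted back (unzip1 (z n)), is_prefix (h n)
  & exists L r, z n = (s n, L) :: r].

Let next_ok n : inv n ->
  edge (s n) (s n.+1) /\
  exists L r, z n = (s n, L) :: r /\ bad_move V r (s n) L (s n.+1).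
Proof.
case=> lz _ _ ph [L [r e]].
have sE : s n.+1 = next (z n) (h n) by rewrite /s /h /= last_rcons.
move: lz; rewrite e /= => -[LE lo _]; subst L.
have [ann h1 h2] := lamP lo; move: sE; rewrite e /=.
have [sP|sP] := boolP (s n \in P1 G) => sE.
  have ed : edge (s n) (s n.+1).
    have [a [h' eh]] := is_prefix_split ph.
    rewrite sE; have := @sigma_strategy (belast a h') (last a h').
    rewrite -lastI -eh => /(_ ph); rewrite /s eh; apply.
    by move: sP; rewrite /s eh.
  split=> //; exists (lam r (s n)), r; split=> //; exact: h1.
have [t ed bm] := h2 sP.
have ex : exists t, edge (s n) t /\ bad_move V r (s n) (lam r (s n)) t.
  by exists t.
have [ed' bm'] := epsilon_spec (inhabits (init G)) _ ex.
rewrite sE; split; first exact: ed'.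
by exists (lam r (s n)), r; split=> //; exact: bm'.
Qed.

Let zS n : z n.+1 = move (z n) (s n.+1).
Proof. by rewrite /s /h /= last_rcons. Qed.

Let hS n : h n.+1 = rcons (h n) (s n.+1).
Proof. by rewrite /s /h /= last_rcons. Qed.

Let inv_all n : inv n.
Proof.
elim: n => [|n IH].
  split=> //=; last by exists (lam [::] (init G)), [::].
  by rewrite eqxx.
have [ed [L [r [e bm]]]] := next_ok IH.
have [cl un so ph _] := IH.
have ph' : is_prefix (h n.+1).
  have [a [h' eh]] := is_prefix_split ph; rewrite hS eh.
  by rewrite is_prefix_rcons -eh ph; move: ed; rewrite {1}/s eh.
rewrite /inv ph' zS /move.
have [tz|tz] := boolP (s n.+1 \in unzip1 (z n)).
  have lt : (index (s n.+1) (unzip1 (z n)) < size (z n))%N.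
    by rewrite -(size_map (@fst _ _)) index_mem.
  split=> //; first exact: labels_drop.
  - by rewrite /unzip1 map_drop drop_uniq.
  - by rewrite /unzip1 map_drop drop_sorted.
  - rewrite (drop_nth (s n.+1, [::]) lt).
    exists (nth (s n.+1, [::]) (z n) (index (s n.+1) (unzip1 (z n)))).2.
    exists (drop (index (s n.+1) (unzip1 (z n))).+1 (z n)).
    congr (_ :: _); rewrite [LHS]surjective_pairing; congr (_, _).
    by rewrite -(nth_map _ (s n.+1)) // nth_index.
move: bm; rewrite /bad_move -e => -[[tz' _]|[_ lo]]; first by rewrite tz' in tz.
split=> //=; first by rewrite tz un.
  by rewrite e /= ed; move: so; rewrite e.
by exists (lam (z n) (s n.+1)), (z n).
Qed.

Let p n := s n.

Let hE n : h n = play_prefix p n.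
Proof. by elim: n => // n IH; rewrite hS IH /play_prefix [in RHS]mkseqS. Qed.

Let p_play : is_play p.
Proof. by split=> // n; have [] := next_ok (inv_all n). Qed.

Let p_consistent : consistent sigma p.
Proof.
move=> n sP; have [_ _ _ _ [L [r e]]] := inv_all n.
by rewrite /p {1}/s hS last_rcons -hE /s /h /= last_rcons -/(z n) e /= -/(p n) sP.
Qed.

Let E n := EL (h n).

Lemma losing_play_false : False.
Proof.
have [v0 Hv0] := sigma_winning.
have E0 n i : 0 <= (v0 i)%:Z + E n i by rewrite /E hE; apply: Hv0.
have zbound n : (size (z n) <= #|S|)%N.
  have [_ un _ _ _] := inv_all n.
  by rewrite -(size_map (@fst _ _)) -(card_uniqP un) max_card.
(* From [N] on the height never falls below [i] and returns to [i] infinitely often: any two such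
   returns bound an admissible segment. *)
have [i [N [leN infi]]] := exists_liminf zbound.
have inf N' : exists n, (N' <= n)%N /\ ((N <= n)%N /\ size (z n) = i).
  have [n [Nn sn]] := infi (maxn N N').
  by exists n; move: Nn; rewrite geq_max => /andP[].
have [phi [incphi Hphi]] := increasing_choice inf.
(* With the initial credit added all levels are nonnegative, so [absz] preserves their order. *)
have [psi [incpsi Hpsi]] := nondecreasing_subseqs (enum 'I_k)
  (fun n x => absz ((v0 x)%:Z + E (phi n) x)).
have lt01 : (phi (psi 0) < phi (psi 1))%N.
  by apply: increasing_ltn => //; exact: incpsi.
apply: (@no_recurrent_segment _ V lam z s E _ _ _ _ _ _ _ _ lt01) => //.
- move=> t; have [_ _ _ ph [L [r e]]] := inv_all t.
  rewrite /E hS; have [a [h' eh]] := is_prefix_split ph.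
  rewrite eh EL_rcons e /= {2}/s eh /= addrAC subrr add0r addrK //.
- by move=> t; have [_ _ _ _ [L [r ->]]] := inv_all t.
- move=> t; have [cl _ _ _ _] := inv_all t.
  elim: (z t) cl => //= e r IH [le lo cl] e'; rewrite inE => /predU1P[->|].
    by rewrite le; have [] := lamP lo.
  exact: IH.
- move=> t tz; have [ed [L [r [e bm]]]] := next_ok (inv_all t).
  by move: bm; rewrite /bad_move -e => -[[] //|[]]; rewrite tz.
- move=> t tz; have [_ un so _ [L [r e]]] := inv_all t; apply: effV.
    by rewrite /unzip1 map_take take_uniq.
  rewrite /unzip1 map_take; apply: take_path.
  by have [ed _] := next_ok (inv_all t); move: so; rewrite e /= ed.
- by rewrite !(Hphi _).2.
- move=> t /andP[h1 h2]; rewrite (Hphi _).2 leN // (leq_trans _ h1) //.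
  exact: (Hphi _).1.
- move=> x; have := Hpsi x; rewrite mem_enum => /(_ isT 0 1 isT) /=.
  by rewrite -lez_nat !abszE !ger0_norm // lerD2l.
Qed.

End Refute.

Lemma winning_not_lose : ~ lose V [::] (init G).
Proof. exact: losing_play_false. Qed.

End Winning.

(** * Small normals *)

Section Dirichlet.
Local Open Scope ring_scope.
Variables (k : nat) (J : finType) (g : J -> vec k) (gam T : nat).
Hypothesis T0 : (0 < T)%N.
Hypothesis gP : forall j, \sum_i `|g j i| <= gam%:Z.

(** Integrality: [s > 0] gives [M * t > - M], hence [t >= 0]; [s < 0] is symmetric, and [s = 0]
    leaves [|M * t| < M]. *)
Lemma dirichlet_sign (s t D : int) (q M : nat) : (0 < q)%N ->
  M%:Z * t = q%:Z * s - D -> `|D| < M%:Z -> 0 <= s * t /\ (s = 0 -> t = 0).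
Proof.
move=> q0 e h; have [s0|s0|s0] := ltrgtP s 0.
- split=> [|es]; last by rewrite es ltxx in s0.
  rewrite nmulr_rge0 //; have [//|t0] := leP t 0.
  have h1 : M%:Z <= M%:Z * t by rewrite ler_peMr.
  have h2 : q%:Z * s <= 0 by rewrite mulr_ge0_le0 // ltW.
  by move: h1 h2 h; rewrite e; move: (_ * _) => z; lia.
- split=> [|es]; last by rewrite es ltxx in s0.
  rewrite pmulr_rge0 //; have [//|t0] := leP 0 t.
  have h1 : M%:Z * t <= - M%:Z by rewrite -mulrN1 ler_wpM2l //; lia.
  have h2 : 0 <= q%:Z * s by rewrite mulr_ge0 // ltW.
  by move: h1 h2 h; rewrite e; move: (_ * _) => z; lia.
- move: e; rewrite s0 mulr0 sub0r mul0r => e; split=> // _; apply/eqP.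
  move: h; rewrite -normrN -e normrM; apply: contraTT => t0; rewrite -leNgt.
  by rewrite ger0_norm // ler_peMr //; move: t0; clear; lia.
Qed.

Lemma dirichlet_key (m d1 d2 r1 r2 q1 q2 w v : int) :
  q1 * w = m * d1 + r1 -> q2 * w = m * d2 + r2 ->
  m * ((d2 - d1) * v) = (q2 - q1) * (w * v) - v * (r2 - r1).
Proof.
move=> h1 h2; have -> : r1 = q1 * w - m * d1 by rewrite h1; ring.
have -> : r2 = q2 * w - m * d2 by rewrite h2; ring.
ring.
Qed.

Lemma eq_divn_dist (m a b : nat) : (0 < m)%N -> (a %/ m = b %/ m)%N ->
  `|a%:Z - b%:Z| < m%:Z.
Proof.
move=> m0 e; rewrite (divn_eq a m) (divn_eq b m) e !PoszD.
have := ltn_pmod a m0; have := ltn_pmod b m0.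
move: (_ %/ _ * _)%N (a %% m)%N (b %% m)%N => x y z; lia.
Qed.

(** Simultaneous approximation of the direction of [w]. The pigeonhole runs over the remainders
    evaluated on the generators [g j], not over their coordinates, so the exponent is the number of
    generators. *)
Lemma dirichlet (w : vec k) : nonneg w -> w != 0 ->
  exists c : vec k, [/\ nonneg c, c != 0,
    forall i, c i <= ((2 * gam * T).+1 ^ #|J|)%:Z,
    forall i, w i = 0 -> c i = 0
  & forall (v : vec k) (f : J -> int), (forall i, v i = \sum_j f j * g j i) ->
     \sum_j `|f j| <= T%:Z ->
     0 <= dot w v * dot c v /\ (dot w v = 0 -> dot c v = 0)].
Proof.
move=> w0 wn0; pose wn i := absz (w i).
have wE i : w i = wn i :> int by rewrite /wn abszE ger0_norm // (nonnegP w w0).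
have [i1 wi1] : exists i, w i != 0.
  apply/existsP; apply: contraNT wn0; rewrite negb_exists => /forallP h.
  by apply/eqP/ffunP => i; rewrite ffunE; apply/eqP; rewrite -[_ == _]negbK.
have [i0 _ i0max] : exists2 i0, true & forall i, (wn i <= wn i0)%N.
  have [i0 _ h] := arg_maxnP (P := predT) wn (isT : predT i1); exists i0 => // i.
  exact: h.
(* Dividing by the largest coordinate makes [c i0 = q2 - q1], which is positive, and keeps every
   coordinate of [c] at most [q2]. *)
set m := wn i0.
have m0 : (0 < m)%N.
  by apply: leq_trans (i0max i1); rewrite /wn absz_gt0.
pose r (q : nat) i := ((q * wn i) %% m)%N.
pose d (q : nat) i := ((q * wn i) %/ m)%N.
have rd q i : (q * wn i)%:Z = m%:Z * (d q i)%:Z + (r q i)%:Z.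
  by rewrite -PoszM -PoszD mulnC [in LHS]mulnC /d /r mulnC [(m * _)%N]mulnC -divn_eq.
have rm q i : (r q i < m)%N by rewrite ltn_mod.
pose y q j : int := \sum_i g j i * (r q i)%:Z.
have yb q j : `|y q j| <= (gam * m)%:Z.
  apply: le_trans (ler_norm_sum _ _ _) _; rewrite PoszM.
  apply: (@le_trans _ _ ((\sum_i `|g j i|) * m%:Z)); last by rewrite ler_wpM2r.
  rewrite mulr_suml; apply: ler_sum => i _; rewrite normrM ler_wpM2l //.
  by rewrite ger0_norm // lez_nat ltnW.
(* Shifted to be nonnegative and scaled by [T]: equal quotients by [m] make the two values of [y]
   differ by less than [m / T], so combinations of total multiplicity [T] differ by less than
   [m]. *)
pose a q j := (absz (y q j + (gam * m)%N%:Z)%R * T)%N.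
have aE q j : (a q j)%:Z = (y q j + (gam * m)%:Z) * T%:Z.
  rewrite /a PoszM abszE ger0_norm //; have := yb q j; move: (y _ _) => z.
  by move: (gam * m)%N => u; lia.
have ab q j : (a q j %/ m < (2 * gam * T).+1)%N.
  rewrite ltn_divLR // -ltz_nat aE.
  have h : y q j + (gam * m)%:Z <= (2 * gam * m)%:Z.
    by have := yb q j; rewrite -mulnA; move: (y _ _) (gam * m)%N => z u; lia.
  apply: le_lt_trans (ler_wpM2r (_ : 0 <= T%:Z) h) _ => //.
  by rewrite -PoszM ltz_nat mulSn; move: m0; clear; lia.
set B := ((2 * gam * T).+1 ^ #|J|)%N.
pose F (q : 'I_B.+1) : {ffun J -> 'I_(2 * gam * T).+1} := [ffun j => Ordinal (ab q j)].
have : ~~ injectiveb F.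
  apply/negP => /injectiveP/leq_card.
  by rewrite card_ord card_ffun card_ord ltnn.
move=> /injectivePn[q1' [q2' neq Feq]].
have [q1 [q2 [q12 q2B same]]] : exists q1 q2 : nat, [/\ (q1 < q2)%N, (q2 <= B)%N &
    forall j, (a q1 j %/ m = a q2 j %/ m)%N].
  have eqa j : (a q1' j %/ m = a q2' j %/ m)%N.
    by have /ffunP/(_ j) := Feq; rewrite !ffunE => /(congr1 val).
  have [lt|lt|e] := ltngtP q1' q2'; last by case/eqP: neq; apply: val_inj.
  - by exists q1', q2'; split=> //; rewrite -ltnS.
  - by exists q2', q1'; split=> //; rewrite -ltnS.
have dle i : (d q1 i <= d q2 i)%N by rewrite leq_div2r // leq_mul2r ltnW // orbT.
pose c : vec k := [ffun i => (d q2 i - d q1 i)%N%:Z].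
have cE i : c i = (d q2 i)%:Z - (d q1 i)%:Z by rewrite ffunE subzn.
exists c; split.
- by apply/nonnegP => i; rewrite ffunE.
- apply/eqP => /ffunP/(_ i0); rewrite cE ffunE /d -/m !mulnK //.
  by move: q12; clear; lia.
- move=> i; rewrite ffunE lez_nat; apply: leq_trans (leq_subr _ _) _.
  apply: leq_trans q2B; rewrite -{2}(mulnK q2 m0); apply: leq_div2r.
  by rewrite leq_mul2l i0max orbT.
- move=> i wi; rewrite cE /d; have -> : wn i = 0%N by rewrite /wn wi.
  by rewrite !muln0 div0n.
move=> v f vE fT.
have key : m%:Z * dot c v = (q2 - q1)%N%:Z * dot w v
    - \sum_j f j * (y q2 j - y q1 j).
  have -> : \sum_j f j * (y q2 j - y q1 j) =
      \sum_i v i * ((r q2 i)%:Z - (r q1 i)%:Z).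
    under eq_bigr => j _ do rewrite /y -sumrB mulr_sumr.
    rewrite exchange_big; apply: eq_bigr => i _; rewrite vE mulr_suml.
    by apply: eq_bigr => j _; ring.
  rewrite /dot !mulr_sumr -sumrB; apply: eq_bigr => i _.
  rewrite cE wE -subzn ?(ltnW q12) //.
  by apply: dirichlet_key; rewrite -PoszM rd.
have small : `|\sum_j f j * (y q2 j - y q1 j)| < m%:Z.
  have yy j : T%:Z * `|y q2 j - y q1 j| <= m%:Z - 1.
    have := eq_divn_dist m0 (same j); rewrite !aE -mulrBl distrC normrM.
    rewrite opprD addrACA subrr addr0 [`|T%:Z|]ger0_norm // mulrC.
    by move: (_ * _) => z; lia.
  suff h : T%:Z * `|\sum_j f j * (y q2 j - y q1 j)| <= T%:Z * (m%:Z - 1).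
    by move: h; rewrite ler_pM2l //; move: (`|_|) => z; lia.
  apply: le_trans (_ : \sum_j `|f j| * (T%:Z * `|y q2 j - y q1 j|) <= _).
    apply: le_trans (ler_wpM2l _ (ler_norm_sum _ _ _)) _ => //.
    by rewrite mulr_sumr; apply: ler_sum => j _; rewrite normrM mulrCA.
  apply: le_trans (_ : \sum_j `|f j| * (m%:Z - 1) <= _).
    by apply: ler_sum => j _; rewrite ler_wpM2l.
  by rewrite -mulr_suml ler_wpM2r // subr_ge0 lez_nat.
by apply: dirichlet_sign key small; rewrite subn_gt0.
Qed.

End Dirichlet.

(** * Cycle effects and bounded normals of a game *)

Section Arena.
Local Open Scope ring_scope.
Variable G : game.
Notation S := (state G).
Notation k := (gdim G).
Notation W := (max_weight G).
Notation rho := (W * #|S|)%N.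
Hypothesis W0 : (0 < W)%N.

Lemma card_state_gt0 : (0 < #|S|)%N.
Proof. by apply/card_gt0P; exists (init G). Qed.

Lemma rho_gt0 : (0 < rho)%N.
Proof. by rewrite muln_gt0 W0 card_state_gt0. Qed.

Lemma gdim_gt0 : (0 < k)%N.
Proof.
rewrite lt0n; apply: contraTneq W0 => k0; rewrite -leqNgt leqn0 -leqn0.
apply/bigmax_leqP => e _; rewrite big1 // => i _.
by have := ltn_ord i; rewrite {2}k0.
Qed.

Lemma weight_le (x y : S) i : edge x y -> `|weight x y i| <= W%:Z.
Proof.
move=> xy; rewrite -abszE lez_nat.
apply: leq_trans (leq_bigmax_cond (F := fun e : S * S =>
  \max_(i < k) absz (weight e.1 e.2 i)) (x, y) xy).
exact: (leq_bigmax (F := fun i : 'I_k => absz (weight x y i))).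
Qed.

Definition wt (e : S * S) : vec k := if edge e.1 e.2 then weight e.1 e.2 else 0.

Lemma wt_le e i : `|wt e i| <= W%:Z.
Proof. by rewrite /wt; case: ifP => [/weight_le|_]; rewrite ?ffunE. Qed.

Definition owt (o : option (S * S)) : vec k := if o is Some e then wt e else 0.

Lemma owt_sum (e : seq (option (S * S))) : exists f : S * S -> int,
  (forall i, (\sum_(o <- e) owt o) i = \sum_x f x * wt x i) /\
  \sum_x `|f x| <= (size e)%:Z.
Proof.
elim: e => [|[x|] e [f [fE fT]]].
- exists (fun => 0); split=> [i|]; last by rewrite big1.
  by rewrite big_nil ffunE big1 // => x _; rewrite mul0r.
- exists (fun y => f y + (y == x)%:R); split=> [i|].
    rewrite big_cons ffunE fE; under [RHS]eq_bigr do rewrite mulrDl.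
    rewrite big_split /= addrC; congr (_ + _).
    rewrite (bigD1 x) //= eqxx mul1r big1 ?addr0 // => y yx.
    by rewrite (negbTE yx) mul0r.
  apply: le_trans (_ : \sum_y (`|f y| + (y == x)%:R) <= _).
    apply: ler_sum => y _; apply: le_trans (ler_normD _ _) _.
    by rewrite lerD2l; case: eqP.
  rewrite big_split /= -addn1 PoszD lerD //.
  by rewrite (bigD1 x) //= eqxx big1 ?addr0 // => y /negbTE ->.
- exists f; split=> [i|]; first by rewrite big_cons add0r fE.
  by apply: le_trans fT _; rewrite lez_nat /=.
Qed.

(** Contains the effects of all simple paths and cycles: padding with [None] gives them the common
    length [#|S|], and only edge multiplicities matter. The unit vectors make conformity to the
    directions include conformity of coordinates. *)
Definition dirs : seq (vec k) := undup (
  [seq unitv i | i <- enum 'I_k] ++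
  [seq \sum_(o <- tval t) owt o | t <- enum {: #|S|.-tuple (option (S * S))}]).

Lemma unitv_dirs i : unitv i \in dirs.
Proof. by rewrite mem_undup mem_cat map_f // mem_enum. Qed.

Lemma dirsP v : v \in dirs -> (exists i, v = unitv i) \/
  exists t : #|S|.-tuple (option (S * S)), v = \sum_(o <- tval t) owt o.
Proof.
rewrite mem_undup mem_cat => /orP[/mapP[i _ ->]|/mapP[t _ ->]]; first by left; exists i.
by right; exists t.
Qed.

Lemma dirs_le v i : v \in dirs -> `|v i| <= rho%:Z.
Proof.
case/dirsP => [[j ->]|[t ->]].
  by rewrite ffunE; case: eqP => _; rewrite ?normr0 // normr1 lez_nat rho_gt0.
rewrite sum_ffunE; apply: le_trans (ler_norm_sum _ _ _) _.
apply: (@le_trans _ _ (\sum_(o <- t) W%:Z)).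
  by apply: ler_sum => -[e|] _; rewrite ?wt_le // ffunE.
by rewrite big_const_seq iter_addr_0 count_predT size_tuple -mulr_natr natz PoszM.
Qed.

Lemma size_dirs : (size dirs <= (2 * rho).+1 ^ k)%N.
Proof.
pose f (v : vec k) : {ffun 'I_k -> 'I_(2 * rho).+1} :=
  [ffun i => inord (absz (v i + rho%:Z))].
have inj : {in dirs &, injective f}.
  move=> u v ud vd /ffunP e; apply/ffunP => i; have := e i; rewrite !ffunE.
  have := dirs_le i ud; have := dirs_le i vd.
  move: (u i) (v i) rho => a b r ha hb /(congr1 val) /=.
  by rewrite !inordK; lia.
rewrite -(size_map f); have un : uniq (map f dirs).
  by rewrite map_inj_in_uniq // undup_uniq.
rewrite -(card_uniqP un); apply: leq_trans (max_card _) _.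
by rewrite card_ffun !card_ord.
Qed.

Lemma eff_dirs (c : seq (S * seq (vec k))) (s : S) : uniq (unzip1 c) ->
  path (fun t x : S => edge x t) s (unzip1 c) -> eff c s \in dirs.
Proof.
move=> un pa; have [e [se ->]] : exists e : seq (option (S * S)),
    size e = size c /\ eff c s = \sum_(o <- e) owt o.
  elim: c s {un} pa => [|x c IH] s /=; first by exists [::]; rewrite big_nil.
  case/andP=> ed /IH[e [se ->]]; exists (Some (x.1, s) :: e).
  by rewrite /= se big_cons /= /wt /= ed.
have le : (size e <= #|S|)%N.
  by rewrite se -(size_map (@fst _ _)) -(card_uniqP un) max_card.
pose t := e ++ nseq (#|S| - size e) None.
have st : size t == #|S| by rewrite size_cat size_nseq subnKC.
rewrite mem_undup mem_cat; apply/orP; right; apply/mapP.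
exists (Tuple st); rewrite ?mem_enum //= big_cat /= -[LHS]addr0; congr (_ + _).
by rewrite big_nseq iter_fix ?addr0.
Qed.

(* The exponents [k] and [#|S| ^ 2] come from describing the cycle effects by
   their coordinates and by edge multiplicities. *)
Definition dir_bound := ((2 * (k * rho)).+1 ^ minn k (#|S| ^ 2))%N.

Definition normals : seq (vec k) :=
  [seq c <- [seq [ffun i => (c i : nat)%:Z] |
     c : {ffun 'I_k -> 'I_dir_bound.+1}] | c != 0].

Lemma normalsP c : reflect
  [/\ nonneg c, c != 0 & forall i, c i <= dir_bound%:Z] (c \in normals).
Proof.
rewrite mem_filter; apply: (iffP andP) => [[c0 /imageP[f _ e]]|[c1 c0 cB]].
  split=> //; first by apply/nonnegP => i; rewrite e ffunE.
  by move=> i; rewrite e ffunE lez_nat -ltnS.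
split=> //; apply/imageP; exists [ffun i => inord (absz (c i))] => //.
apply/ffunP => i; rewrite !ffunE inordK; last first.
  by have := cB i; have := nonnegP _ c1 i; move: (c i) dir_bound => a b; clear; lia.
by rewrite abszE ger0_norm // (nonnegP _ c1).
Qed.

Lemma normals_conformal w : nonneg w -> w != 0 -> exists c,
  [/\ c \in normals, c != 0 & forall v, v \in dirs ->
      0 <= dot w v * dot c v /\ (dot w v = 0 -> dot c v = 0)].
Proof.
move=> w0 wn0.
have unit_ok c : nonneg c -> (forall i, w i = 0 -> c i = 0) -> forall i,
    0 <= dot w (unitv i) * dot c (unitv i) /\
    (dot w (unitv i) = 0 -> dot c (unitv i) = 0).
  move=> c0 wc i; rewrite !dot_unitv; split; last exact: wc.
  by rewrite mulr_ge0 // ?(nonnegP _ w0) ?(nonnegP _ c0).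
(* Generators are the [k] unit vectors, with [gam = 1] and [T = k * rho], or the edges, with
   [gam = k * W] and [T = #|S|]; the product [gam * T] is the same. *)
have [le|lt] := leqP k (#|S| ^ 2).
  have T0 : (0 < k * rho)%N by rewrite muln_gt0 gdim_gt0 rho_gt0.
  have g1 (j : 'I_k) : \sum_i `|unitv j i| <= 1%N%:Z.
    rewrite (bigD1 j) //= ffunE eqxx normr1 big1 ?addr0 // => i ij.
    by rewrite ffunE (negbTE ij) normr0.
  have [c [c0 cn0 cB wc Hc]] := dirichlet T0 g1 w0 wn0.
  exists c; split=> //.
    by apply/normalsP; split=> // i; have := cB i;
       rewrite card_ord muln1 /dir_bound (minn_idPl le).
  move=> v vd; apply: (Hc v (fun i => v i)).
    move=> i; rewrite (bigD1 i) //= ffunE eqxx mulr1 big1 ?addr0 // => j ij.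
    by rewrite ffunE eq_sym (negbTE ij) mulr0.
  apply: (@le_trans _ _ (\sum_(j < k) rho%:Z)).
    by apply: ler_sum => i _; exact: dirs_le.
  by rewrite sumr_const card_ord -mulr_natl natz -PoszM.
have g1 (e : S * S) : \sum_i `|wt e i| <= (k * W)%N%:Z.
  apply: (@le_trans _ _ (\sum_(j < k) W%:Z)).
    by apply: ler_sum => i _; exact: wt_le.
  by rewrite sumr_const card_ord -mulr_natl natz -PoszM.
have [c [c0 cn0 cB wc Hc]] := dirichlet card_state_gt0 g1 w0 wn0.
exists c; split=> //.
  apply/normalsP; split=> // i; have := cB i.
  by rewrite card_prod /dir_bound (minn_idPr (ltnW lt)) -mulnn -!mulnA.
move=> v /dirsP[[i ->]|[t ->]]; first exact: unit_ok.
have [f [fE fT]] := owt_sum (tval t).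
by apply: (Hc _ f) => //; rewrite size_tuple in fT.
Qed.

End Arena.

(** * The controller *)

Section Older.
Variable T : eqType.
Implicit Types (B C : seq T) (b : T).

Definition older B b := take (index b B).+1 B.

Lemma mem_older B b : b \in B -> b \in older B b.
Proof.
move=> bB; rewrite /older (take_nth b) ?index_mem // mem_rcons.
by rewrite nth_index // mem_head.
Qed.

(** Lows leave by filtering and enter at the end, so the elders of a surviving low can only become
    fewer. *)
Lemma older_filter_cat (P : pred T) B C b : b \in B -> P b ->
  older (filter P B ++ C) b = filter P (older B b).
Proof.
rewrite /older => + Pb; elim: B => //= x B IH; rewrite inE.
have [<-|xb] /= := eqVneq b x; first by rewrite Pb /= eqxx !take0.
by move=> /IH e; case: (P x) => /=; rewrite ?e // eq_sym (negbTE xb) /= e.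
Qed.

End Older.

(** * Coverage, announcements and the potential *)

Section Lists.
Local Open Scope ring_scope.
Variable k : nat.
Variable V : seq (vec k).
Implicit Types (a b : vec k) (A B O P : seq (vec k)).

Definition covcount O := count (fun v => has (fun a => dot a v != 0) O) V.

Lemma covcount_le O : (covcount O <= size V)%N.
Proof. exact: count_size. Qed.

Lemma covers_mem O a : a \in O -> covers V O a.
Proof. by move=> aO; apply/allP => v _; apply/implyP => av; apply/hasP; exists a. Qed.

Lemma covers_sub O O' a : {subset O' <= O} -> covers V O' a -> covers V O a.
Proof.
move=> sub /allP h; apply/allP => v /h /implyP h'; apply/implyP => /h'.
by case/hasP=> b /sub bO bv; apply/hasP; exists b.
Qed.

Lemma covcount_sub O O' : {subset O' <= O} -> (covcount O' <= covcount O)%N.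
Proof.
move=> sub; apply: leq_count => v _ /hasP[b /sub bO bv].
by apply/hasP; exists b.
Qed.

Lemma covers_eq O O' a : {subset O' <= O} -> covcount O' = covcount O ->
  covers V O' a = covers V O a.
Proof.
move=> sub e; apply/idP/idP; first exact: covers_sub.
move=> /allP h; apply/allP => v vV; apply/implyP => av.
have := h v vV; rewrite av /= => hO; apply: contraT => hO'.
suff : (covcount O' < covcount O)%N by rewrite e ltnn.
apply: (ltn_count _ vV hO hO') => u _ /hasP[b /sub bO bv].
by apply/hasP; exists b.
Qed.

Definition extend A B := foldl (fun A b => if covers V A b then A else rcons A b) A B.

Lemma extend_cat A B B' : extend A (B ++ B') = extend (extend A B) B'.
Proof. by rewrite /extend foldl_cat. Qed.

Lemma extend_prefix A B : exists2 C, extend A B = A ++ C & {subset C <= B}.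
Proof.
elim: B A => [|b B IH] A /=; first by exists [::]; rewrite ?cats0.
rewrite /extend /= -/(extend _ _); case: ifP => _.
  have [C -> sub] := IH A; exists C => // c /sub cB; by rewrite inE cB orbT.
have [C -> sub] := IH (rcons A b); exists (b :: C); first by rewrite cat_rcons.
by move=> c; rewrite !inE => /orP[->//|/sub ->]; rewrite orbT.
Qed.

Lemma extend_covers A B b : b \in B -> covers V (extend A B) b.
Proof.
elim: B A => //= c B IH A; rewrite inE => /predU1P[->|/IH]; last exact.
rewrite /extend /= -/(extend _ _); case: ifP => h.
  have [C -> _] := extend_prefix A B; apply: covers_sub h => x.
  by rewrite mem_cat => ->.
have [C -> _] := extend_prefix (rcons A c) B; apply: covers_mem.
by rewrite mem_cat mem_rcons mem_head.
Qed.

(** Bounds the length of an announcement by [size V], since an entry is appended only if it sees a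
    new direction; stated for prefixes so that cutting preserves it. *)
Definition tight A := forall j, (j <= size A)%N -> (j <= covcount (take j A))%N.

Lemma tight_size A : tight A -> (size A <= size V)%N.
Proof.
by move=> /(_ (size A) (leqnn _)) h; apply: leq_trans h (covcount_le _).
Qed.

Lemma tight_take A i : tight A -> tight (take i A).
Proof.
move=> h j; rewrite size_take_min leq_min => /andP[ji jA].
by rewrite take_takel // h.
Qed.

Lemma tight_extend A B : tight A -> tight (extend A B).
Proof.
elim: B A => //= b B IH A tA; rewrite /extend /= -/(extend _ _).
case: ifP => h; first exact: IH.
apply: IH => j; rewrite size_rcons leq_eqVlt => /predU1P[->|]; last first.
  rewrite ltnS => jA; rewrite -cats1 takel_cat //; exact: tA.
rewrite -(size_rcons A b) take_size size_rcons.
apply: leq_ltn_trans (tA (size A) (leqnn _)) _; rewrite take_size.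
have /allPn[v vV] := negbT h; rewrite negb_imply => /andP[bv Av].
apply: (ltn_count _ vV _ Av); last by rewrite has_rcons bv.
by move=> u _; rewrite has_rcons => ->; rewrite orbT.
Qed.

Definition cut A B := take (find (fun a => ~~ all (compat V a) B) A) A.

Lemma cut_compat A B a : a \in cut A B -> all (compat V a) B.
Proof.
rewrite /cut; elim: A => //= c A IH; case: ifP => //= /negbFE cB.
by rewrite inE => /predU1P[->|/IH].
Qed.

(* [O] stands for the lows that are at least as old as a given one. *)
Definition phi P O :=
  ((size V).+1 * covcount O + count (fun a => ~~ covers V O a) P)%N.

Lemma phi_le P O : (size P <= size V)%N ->
  (phi P O <= (size V).+1 * size V + size V)%N.
Proof.
move=> PV; apply: leq_add; first by rewrite leq_mul2l covcount_le orbT.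
exact: leq_trans (count_size _ _) PV.
Qed.

Lemma phi_mono P O O' : (size P <= size V)%N -> {subset O' <= O} ->
  (phi P O' <= phi P O)%N.
Proof.
move=> PV sub; have := covcount_sub sub; rewrite leq_eqVlt => /predU1P[e|lt].
  rewrite /phi e leq_add2l; apply: leq_count => a _.
  by rewrite (covers_eq _ sub e).
apply: leq_trans (_ : (size V).+1 * (covcount O').+1 <= _)%N.
  by rewrite /phi mulnS addnC leq_add2r (leq_trans (count_size _ _)) // ltnW.
by apply: leq_trans (leq_addr _ _); rewrite leq_mul2l lt orbT.
Qed.

(** The potential is lexicographic. If [O'] sees fewer directions than [O], the first term drops by
    more than the second can gain. Otherwise coverage is unchanged: the uncovered entry [j] leaves
    the count, and [P], inside [O'], adds nothing to it. *)
Lemma phi_cut A P j O O' : (size A <= size V)%N -> {subset O' <= O} ->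
  (j < size A)%N -> ~~ covers V O' (nth 0 A j) ->
  {subset P <= O'} ->
  forall i, (j < i)%N -> (phi (take j A ++ P) O' < phi (take i A) O)%N.
Proof.
move=> AV sub jA bad PO i ji.
have -> : phi (take j A ++ P) O' = phi (take j A) O'.
  rewrite /phi count_cat [X in (_ + (_ + X))%N](_ : _ = 0)%N ?addn0 //.
  apply/eqP; rewrite -leqn0 leqNgt -has_count; apply/hasPn => a aP.
  by rewrite negbK covers_mem // PO.
have := covcount_sub sub; rewrite leq_eqVlt => /predU1P[e|lt].
  rewrite /phi e ltn_add2l.
  rewrite (eq_count (a2 := fun a => ~~ covers V O a)); last first.
    by move=> a; rewrite (covers_eq _ sub e).
  rewrite (covers_eq _ sub e) in bad.
  have -> : take i A = take j A ++ nth 0 A j :: take (i - j.+1) (drop j.+1 A).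
    by rewrite -cat_rcons -take_nth // -takeD subnKC.
  by rewrite count_cat /= bad add1n addnS ltnS leq_addr.
apply: leq_trans (_ : (size V).+1 * (covcount O').+1 <= _)%N.
  rewrite /phi mulnS [X in (_ <= X)%N]addnC -addnS leq_add2l ltnS.
  apply: leq_trans (count_size _ _) _; rewrite size_take_min.
  exact: leq_trans (geq_minr _ _) AV.
by apply: leq_trans (leq_addr _ _); rewrite leq_mul2l lt orbT.
Qed.

End Lists.

(** * Constants of the controller and update of its announcement *)

Section Controller.
Local Open Scope ring_scope.
Variable G : game.
Notation S := (state G).
Notation k := (gdim G).
Notation W := (max_weight G).
Notation rho := (W * #|S|)%N.
Notation V := (dirs G).
Notation lab := (seq (vec k)).
Notation stack := (seq (S * lab)).
Notation back := (fun t x : S => edge x t).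
Hypothesis W0 : (0 < W)%N.
Implicit Types (a b x : vec k) (A B P O : lab) (p z : stack).

Definition dot_bound := (k * (dir_bound G * rho))%N.
Definition phi_bound := ((size V).+1 * size V + size V)%N.
(** One cycle may cost [dot_bound] as a normal becomes low; the rest is its initial budget, a full
    stack of outdated labels now and one for each later drop of [phi]. *)
Definition theta := (dot_bound * (1 + #|S| * (1 + phi_bound)))%N.
(** Makes [2 * Q] exceed the slack of a low normal plus that of a normal covered by lows, so that
    [slack_incompat] yields compatibility. It also leaves no normal low at the start. *)
Definition qcoef := (dot_bound * (size V * theta) + theta)%N.
(** The first term bounds the closed cycles from below through the slack of unit normals; [rho]
    allows for one more cycle or simple path. *)
Definition floor := (qcoef * (size V * rho) + rho)%N.
(** A normal with a positive coefficient on a capped coordinate has slack at least [theta] whatever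
    the other coordinates, so truncation leaves the slack of low normals unchanged. *)
Definition cap := (k * (dir_bound G * floor) + theta)%N.

Notation slk := (slack V qcoef).
Definition low a x := slk a x < theta%:Z.

Lemma dot_le a v : a \in normals G -> v \in V -> `|dot a v| <= dot_bound%:Z.
Proof.
move=> /normalsP[a0 _ aB] vV; apply: le_trans (ler_norm_sum _ _ _) _.
apply: (@le_trans _ _ (\sum_(i < k) (dir_bound G * rho)%N%:Z)); last first.
  by rewrite sumr_const card_ord -mulr_natl natz -PoszM.
apply: ler_sum => i _; rewrite normrM PoszM; apply: ler_pM => //.
  by rewrite ger0_norm // (nonnegP _ a0).
exact: dirs_le.
Qed.

Lemma normals_nonneg a : a \in normals G -> nonneg a.
Proof. by case/normalsP. Qed.

Lemma slack_all_ge0 x : (forall a, a \in normals G -> 0 <= slk a x) ->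
  forall a, nonneg a -> 0 <= slk a x.
Proof.
move=> h; apply: (slack_ge0_conformal (@unitv_dirs G)) h => w w0 wn0.
exact: normals_conformal.
Qed.

Lemma low_compat a b x : (forall a, a \in normals G -> 0 <= slk a x) ->
  a \in normals G -> b \in normals G -> low b x ->
  slk a x <= (dot_bound * (size V * theta))%:Z \/ low a x -> compat V a b.
Proof.
move=> h aN bN lb la; apply: contraT => nc.
have := slack_incompat (slack_all_ge0 h (nonnegD (normals_nonneg aN)
  (normals_nonneg bN))) nc.
move: lb la; rewrite /low /qcoef.
move: (slk a x) (slk b x) (dot_bound * (size V * theta))%N => s t u.
by move=> ? []; lia.
Qed.

Definition new_lows B x :=
  [seq b <- B | low b x] ++ [seq a <- normals G | low a x & a \notin B].

Definition new_announce A B := extend V (cut V A B) B.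

Definition unseen P p := count (fun e : S * lab => ~~ prefix P e.2) p.

(* Each stacked edge whose label lacks the prefix covering [b] may cost up to
   [dot_bound] when it is popped; [phi] counts how often the prefix may change. *)
Definition budget A B x p := {in B, forall b, exists i,
  [/\ (i <= size A)%N, covers V (take i A) b &
    (dot_bound * (unseen (take i A) p + #|S| * phi V (take i A) (older B b)))%:Z
      <= slk b x]}.

Record controlled A B x : Prop := Controlled {
  ctl_normals : {subset A <= normals G};
  ctl_compat : {in A &, forall a b, compat V a b};
  ctl_tight : tight V A;
  ctl_lows : forall a, (a \in B) = (a \in normals G) && low a x;
  ctl_cross : {in A & B, forall a b, compat V a b} }.

Lemma update A B x x' p : controlled A B x -> (size p <= #|S|)%N ->
  (forall a, a \in normals G -> 0 <= slk a x') ->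
  (forall b, b \in B -> low b x' -> exists i,
    [/\ (i <= size A)%N, covers V (take i A) b &
      (dot_bound * (unseen (take i A) p + #|S| * phi V (take i A) (older B b)))%:Z
        <= slk b x']) ->
  (forall a, a \in normals G -> a \notin B -> low a x' ->
    (dot_bound * (#|S| * (1 + phi_bound)))%:Z <= slk a x') ->
  let B' := new_lows B x' in let A' := new_announce A B' in
  controlled A' B' x' /\ budget A' B' x' p.
Proof.
move=> [AN AA At Bl AB] pS s0 old fresh B' A'.
have B'l a : (a \in B') = (a \in normals G) && low a x'.
  rewrite mem_cat 2!mem_filter Bl.
  by case: (a \in normals G); case: (low a x); case: (low a x').
have B'B' : {in B' &, forall a b, compat V a b}.
  move=> a b; rewrite !B'l => /andP[aN la] /andP[bN lb].
  by apply: (low_compat s0) => //; right.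
pose j := find (fun a => ~~ all (compat V a) B') A.
have cutE : cut V A B' = take j A by [].
have [C A'E CB'] := extend_prefix V (take j A) B'.
rewrite -cutE -/(new_announce A B') -/A' cutE in A'E.
have jA : (size (take j A) <= size A)%N by rewrite size_take_min geq_minr.
have A'at : tight V A' by apply: tight_extend; apply: tight_take.
have A'N : {subset A' <= normals G}.
  move=> a; rewrite A'E mem_cat => /orP[/mem_take/AN//|/CB'].
  by rewrite B'l => /andP[].
have A'B' : {in A' & B', forall a b, compat V a b}.
  move=> a b; rewrite A'E mem_cat => /orP[aj|/CB' aB'] bB'; last exact: B'B'.
  by rewrite -cutE in aj; exact: (allP (cut_compat aj)).
split.
  split=> // a b; rewrite {1}A'E mem_cat => /orP[aj|/CB' aB'] bA'; last first.
    by rewrite compatC; exact: A'B'.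
  move: bA'; rewrite A'E mem_cat => /orP[/mem_take bA|/CB' bB'].
    by apply: AA => //; exact: mem_take aj.
  by apply: A'B' => //; rewrite A'E mem_cat aj.
move=> b bB'; have := bB'; rewrite B'l => /andP[bN lb].
have [bB|bB] := boolP (b \in B); last first.
  exists (size A'); rewrite take_size; split=> //; first exact: extend_covers.
  apply: le_trans (fresh b bN bB lb); rewrite lez_nat leq_mul2l; apply/orP; right.
  rewrite mulnDr muln1; apply: leq_add.
    exact: leq_trans (count_size _ _) pS.
  by rewrite leq_mul2l phi_le ?orbT // tight_size.
have oE : older B' b = [seq c <- older B b | low c x'].
  by rewrite /B' /new_lows older_filter_cat.
have sub : {subset older B' b <= older B b}.
  by move=> c; rewrite oE mem_filter => /andP[].
have [i [iA cov bud]] := old b bB lb.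
(* Either the cut spares the prefix covering [b], and [phi] cannot grow as elders disappear, or it
   falls inside that prefix. *)
have [ij|ji] := leqP i j.
  have ijA : (i <= size (take j A))%N by rewrite size_take_min leq_min ij.
  have tE : take i A' = take i A by rewrite A'E takel_cat // take_takel.
  exists i; rewrite tE; split=> //.
    by rewrite A'E size_cat (leq_trans ijA) // leq_addr.
  apply: le_trans bud; rewrite lez_nat leq_mul2l leq_add2l leq_mul2l.
  rewrite phi_mono ?orbT //; apply: leq_trans (tight_size At).
  by rewrite size_take_min geq_minr.
have jltA : (j < size A)%N by apply: leq_trans ji iA.
(* Were the entry at the cut covered by these lows, its slack would be small and [low_compat] would
   make it compatible with all of [B'], against the choice of [j]. *)
have bad : ~~ covers V (older B' b) (nth 0 A j).
  have aA : nth 0 A j \in A by rewrite mem_nth.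
  have : ~~ all (compat V (nth 0 A j)) B'.
    by apply: (nth_find 0 (a := fun a => ~~ all (compat V a) B')); rewrite has_find.
  case/allPn=> c cB' nc; apply: contra nc => cova.
  have := cB'; rewrite B'l => /andP[cN lc].
  apply: (low_compat s0 (AN _ aA) cN lc); left.
  apply: (slack_covered_le (@unitv_dirs G) (slack_all_ge0 s0) _ _ _ cova).
  - exact/normals_nonneg/AN.
  - by move=> v; apply: dot_le; exact: AN.
  - move=> l lO; have lB := mem_take (sub _ lO).
    have : l \in B' := mem_take lO; rewrite B'l => /andP[lN ll].
    by split; [exact: normals_nonneg | exact: AB | exact: ltW].
(* As [older B' b] is a prefix of [B'], [A1] is a prefix of [A']; what it adds lies among the elders
   of [b], as [phi_cut] requires. *)
pose A1 := extend V (take j A) (older B' b).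
have [P A1E PO] := extend_prefix V (take j A) (older B' b).
have A'E1 : A' = extend V A1 (drop (index b B').+1 B').
  by rewrite /A1 -extend_cat cat_take_drop.
have [R A'R _] := extend_prefix V A1 (drop (index b B').+1 B').
rewrite -A'E1 in A'R.
exists (size A1); rewrite A'R take_size_cat //; split.
- by rewrite size_cat leq_addr.
- by apply: extend_covers; apply: mem_older.
have lt := @phi_cut _ V A P j _ _ (tight_size At) sub jltA bad PO i ji.
apply: le_trans bud; rewrite lez_nat leq_mul2l; apply/orP; right.
apply: leq_trans (leq_addl _ _); rewrite /A1 A1E.
(* The drop of [phi] releases [#|S|] units, enough to regard every stacked label as outdated. *)
apply: leq_trans (_ : #|S| + #|S| * phi V (take j A ++ P) (older B' b) <= _)%N.
  by rewrite leq_add2r; exact: leq_trans (count_size _ _) pS.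
by rewrite -mulnS leq_mul2l lt orbT.
Qed.

End Controller.

(** * Configurations and their invariant *)

Section Configurations.
Local Open Scope ring_scope.
Variable G : game.
Notation S := (state G).
Notation k := (gdim G).
Notation W := (max_weight G).
Notation rho := (W * #|S|)%N.
Notation V := (dirs G).
Notation lab := (seq (vec k)).
Notation stack := (seq (S * lab)).
Notation back := (fun t x : S => edge x t).
Notation slk := (slack V (qcoef G)).
Hypothesis W0 : (0 < W)%N.
Implicit Types (a b x : vec k) (A B P O : lab) (p z : stack).

(* Stack, current state, truncated sum of the closed cycles, announcement, and the
   nearly tight normals in order of appearance. *)
Record conf := Conf { cp : stack; cs : S; cx : vec k; cA : lab; cB : lab }.

Definition trunc x : vec k := [ffun i => Order.min (x i) (cap G)%:Z].

Definition pushed c : stack := (cs c, cA c) :: cp c.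

Definition step c (t : S) : conf :=
  if t \in unzip1 (pushed c) then
    let x := trunc (cx c + eff (cycle_of (pushed c) t) t) in
    let B := new_lows (cB c) x in
    Conf (rest_of (pushed c) t) t x (new_announce (cA c) B) B
  else Conf (pushed c) t (cx c) (cA c) (cB c).

Fixpoint safe p : Prop :=
  if p is e :: r then ~ lose V r e.1 /\ safe r else True.

Record inv c : Prop := Inv {
  inv_uniq : uniq (cs c :: unzip1 (cp c));
  inv_path : path back (cs c) (unzip1 (cp c));
  inv_lose : ~ lose V (cp c) (cs c);
  inv_safe : safe (cp c);
  inv_ctl : controlled (cA c) (cB c) (cx c);
  inv_budget : budget (cA c) (cB c) (cx c) (cp c);
  inv_cap : forall i, cx c i <= (cap G)%:Z }.

Definition legal c (t : S) : Prop := edge (cs c) t /\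
  ((t \in unzip1 (pushed c) -> good_cycle (cycle_of (pushed c) t) t) /\
   (t \notin unzip1 (pushed c) -> ~ lose V (pushed c) t)).

Lemma inv_slack c a : inv c -> a \in normals G -> 0 <= slk a (cx c).
Proof.
move=> ic aN; have [la|] := boolP (low a (cx c)); last first.
  by rewrite -leNgt; apply: le_trans.
have aB : a \in cB c by rewrite (ctl_lows (inv_ctl ic)) aN.
by have [i [_ _]] := inv_budget ic aB; apply: le_trans.
Qed.

Lemma dir_bound_gt0 : (0 < dir_bound G)%N.
Proof. by rewrite expn_gt0. Qed.

Lemma unitv_normals i : unitv i \in normals G.
Proof.
apply/normalsP; split.
- by apply/nonnegP => j; rewrite ffunE; case: eqP.
- by apply/eqP => /ffunP/(_ i); rewrite !ffunE eqxx.
- by move=> j; rewrite ffunE; case: eqP => _ //; rewrite lez_nat dir_bound_gt0.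
Qed.

Lemma inv_floor c i : inv c -> - (qcoef G * (size V * rho))%N%:Z <= cx c i.
Proof.
move=> ic; have := inv_slack ic (unitv_normals i).
rewrite /slack dotC dot_unitv => h; rewrite lerNl -subr_ge0 opprK.
apply: le_trans h _; rewrite [leRHS]addrC lerD2l PoszM ler_wpM2l //.
rewrite big_seq; apply: (@le_trans _ _ (\sum_(v <- V | v \in V) rho%:Z)).
  by apply: ler_sum => v vV; rewrite dotC dot_unitv dirs_le.
by rewrite -big_seq big_const_seq iter_addr_0 count_predT -mulr_natl natz -PoszM.
Qed.

Lemma trunc_low x a : (forall i, - (floor G)%:Z <= x i) -> a \in normals G ->
  low a (trunc x) -> slk a (trunc x) = slk a x.
Proof.
move=> xf /normalsP[/nonnegP a0 _ aB] la.
have tf i : - (floor G)%:Z <= trunc x i by rewrite ffunE le_min xf; lia.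
suff h i : a i * trunc x i = a i * x i.
  by congr (_ + _); apply: eq_bigr => i _.
rewrite ffunE; case: leP => // capx; have [->|ai] := eqVneq (a i) 0.
  by rewrite !mul0r.
have ti : trunc x i = (cap G)%:Z by rewrite ffunE; case: leP capx => // /lt_geF ->.
suff : (theta G)%:Z <= slk a (trunc x) by rewrite leNgt (_ : slk a _ < _).
apply: (@le_trans _ _ (dot a (trunc x))); last first.
  by rewrite lerDl mulr_ge0 // sumr_ge0.
rewrite /dot (bigD1 i) //= ti.
have h1 : (cap G)%:Z <= a i * (cap G)%:Z.
  by rewrite ler_peMl //; have := a0 i; move: ai; move: (a i); clear; lia.
have h2 : - (k * (dir_bound G * floor G))%N%:Z <=
    \sum_(j < k | j != i) a j * trunc x j.
  rewrite lerNl -sumrN; apply: (@le_trans _ _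
    (\sum_(j < k | j != i) (dir_bound G * floor G)%N%:Z)).
    apply: ler_sum => j _; rewrite -mulrN PoszM.
    apply: le_trans (_ : a j * (floor G)%:Z <= _).
      by rewrite ler_wpM2l // lerNl.
    by rewrite ler_wpM2r.
  apply: (@le_trans _ _ (\sum_(j < k) (dir_bound G * floor G)%N%:Z)).
    by rewrite [leRHS](bigD1 i) //= lerDr.
  by rewrite sumr_const card_ord -mulr_natl natz -PoszM.
move: h1 h2; rewrite /cap; move: (\sum_(_ < _ | _) _) (a i) => s u.
move: (k * _)%N (theta G) => m n h1 h2.
have -> : n%:Z = (m + n)%N%:Z - m%:Z by rewrite PoszD addrAC subrr add0r.
exact: lerD.
Qed.

(** If all labels of the cycle carry the prefix covering [b], the cycle is nonnegative on that
    prefix, and compatibility forbids a negative value of [b]. Otherwise the pop discards an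
    outdated label, whose share [dot_bound] pays for the loss. *)
Lemma good_cycle_pop c t i b : inv c -> t \in unzip1 (pushed c) ->
  good_cycle (cycle_of (pushed c) t) t ->
  b \in cB c -> covers V (take i (cA c)) b ->
  let v := eff (cycle_of (pushed c) t) t in v \in V ->
  (dot_bound G * unseen (take i (cA c)) (rest_of (pushed c) t))%N%:Z <=
  dot b v + (dot_bound G * unseen (take i (cA c)) (cp c))%N%:Z.
Proof.
move=> ic tz gc bB cov v vV; set P := take i (cA c).
have bN : b \in normals G by move: bB; rewrite (ctl_lows (inv_ctl ic)) => /andP[].
have bv : - (dot_bound G)%:Z <= dot b v.
  by have := dot_le W0 bN vV; rewrite ler_norml => /andP[].
(* The freshly pushed label is [cA c] itself, which has the prefix [P] and so adds nothing. *)
have uE : unseen P (cp c) =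
    (unseen P (cycle_of (pushed c) t) + unseen P (rest_of (pushed c) t))%N.
  rewrite -count_cat cat_take_drop /unseen /= /P.
  by rewrite -{3}(cat_take_drop i (cA c)) prefix_prefix.
have [Pc|] := boolP (all (fun e => prefix P e.2) (cycle_of (pushed c) t)).
  have b0 : 0 <= dot b v.
    rewrite leNgt; apply/negP => neg.
    have := allP cov v vV; rewrite lt_eqF //= => /hasP[a aP av].
    have a0 := gc P Pc a aP.
    have aA : a \in cA c by exact: mem_take aP.
    have := allP (ctl_cross (inv_ctl ic) aA bB) v vV.
    by rewrite nmulr_lge0 // leNgt lt_def av a0.
  apply: le_trans (_ : (dot_bound G * unseen P (cp c))%N%:Z <= _).
    by rewrite lez_nat leq_mul2l uE leq_addl orbT.
  by rewrite lerDr.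
rewrite -has_predC has_count => u0.
rewrite uE mulnDr PoszD addrA lerDr.
have : (dot_bound G)%:Z <=
    (dot_bound G * unseen P (cycle_of (pushed c) t))%N%:Z.
  by rewrite lez_nat leq_pmulr.
by move: bv; move: (_ * _)%N => y; move: (dot b v) (dot_bound G) => x z; lia.
Qed.

Lemma step_inv c t : inv c -> legal c t -> inv (step c t).
Proof.
move=> ic [ed [gc nl]]; have [un pa lo sf ct bu ca] := ic.
have unz : uniq (unzip1 (pushed c)) by [].
rewrite /step; case: ifPn => [tz|tz]; last first.
  split=> //=.
  - by rewrite tz.
  - by rewrite ed.
  - exact: nl.
  - move=> b bB; have [i [iA cov bud']] := bu b bB; exists i; split=> //.
    by rewrite /unseen /= -{2}(cat_take_drop i (cA c)) prefix_prefix.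
pose v := eff (cycle_of (pushed c) t) t.
have vV : v \in V.
  apply: eff_dirs; first by rewrite /unzip1 map_take take_uniq.
  by rewrite /unzip1 map_take; apply: take_path; rewrite /= ed.
have lt : (index t (unzip1 (pushed c)) < size (pushed c))%N.
  by rewrite -(size_map (@fst _ _)) index_mem.
have [L restE] : exists L, drop (index t (unzip1 (pushed c))) (pushed c) =
    (t, L) :: rest_of (pushed c) t.
  rewrite (drop_nth (t, [::]) lt).
  exists (nth (t, [::]) (pushed c) (index t (unzip1 (pushed c)))).2.
  congr (_ :: _); rewrite [LHS]surjective_pairing; congr (_, _).
  by rewrite -(nth_map _ t) // nth_index.
have un' : uniq (t :: unzip1 (rest_of (pushed c) t)).
  have := drop_uniq (index t (unzip1 (pushed c))) unz.
  by rewrite -map_drop restE.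
have pS : (size (rest_of (pushed c) t) <= #|S|)%N.
  have := card_uniqP un'; rewrite /= size_map => e.
  by apply: ltnW; rewrite -e max_card.
set x1 := cx c + v; set x' := trunc x1.
have x1f i : - (floor G)%:Z <= x1 i.
  rewrite ffunE /floor PoszD opprD lerD ?inv_floor //.
  by have := dirs_le W0 i vV; rewrite ler_norml => /andP[].
have bv b : b \in normals G -> - (dot_bound G)%:Z <= dot b v.
  by move=> bN; have := dot_le W0 bN vV; rewrite ler_norml => /andP[].
have slkE b : b \in normals G -> low b x' -> slk b x' = slk b (cx c) + dot b v.
  by move=> bN lb; rewrite trunc_low // slackDr.
have old b : b \in cB c -> low b x' -> exists i,
    [/\ (i <= size (cA c))%N, covers V (take i (cA c)) b &
      (dot_bound G * (unseen (take i (cA c)) (rest_of (pushed c) t) +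
        #|S| * phi V (take i (cA c)) (older (cB c) b)))%N%:Z <= slk b x'].
  move=> bB lb; have [i [iA cov bud']] := bu b bB; exists i; split=> //.
  have bN : b \in normals G by move: bB; rewrite (ctl_lows ct) => /andP[].
  rewrite slkE //.
  have := good_cycle_pop ic tz (gc tz) bB cov vV; rewrite -/v.
  move: bud'; rewrite !mulnDr !PoszD.
  move: (dot_bound G * unseen _ (cp c))%N => u1.
  move: (dot_bound G * unseen _ _)%N => u2.
  move: (dot_bound G * (_ * _))%N => u3; move: (dot b v) (slk _ _).
  by clear=> *; lia.
have fresh b : b \in normals G -> b \notin cB c -> low b x' ->
    (dot_bound G * (#|S| * (1 + phi_bound G)))%N%:Z <= slk b x'.
  move=> bN; rewrite (ctl_lows ct) bN /= -leNgt => h1 lb; rewrite slkE //.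
  have := bv b bN; move: h1; rewrite /theta mulnDr muln1.
  move: (dot_bound G * (_ * _))%N => u; move: (dot b v) (slk _ _) (dot_bound G).
  by clear=> *; lia.
have s0 b : b \in normals G -> 0 <= slk b x'.
  move=> bN; have [lb|] := boolP (low b x'); last by rewrite -leNgt; apply: le_trans.
  have [bB|bB] := boolP (b \in cB c).
    by have [i [_ _]] := old b bB lb; apply: le_trans.
  by apply: le_trans (fresh b bN bB lb).
have [ct' bu'] := update W0 ct pS s0 old fresh.
have sz : safe (pushed c) by [].
have [lo' sf'] : ~ lose V (rest_of (pushed c) t) t /\ safe (rest_of (pushed c) t).
  suff h i z : safe z -> safe (drop i z).
    by have := h (index t (unzip1 (pushed c))) _ sz; rewrite restE.
  by elim: z i => [|e z IH] [|i] //= [_ /IH].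
split=> //=.
- have := @drop_sorted _ back (index t (unzip1 (pushed c))) (unzip1 (pushed c)) pa.
  by rewrite /unzip1 -map_drop restE.
- by move=> i; rewrite ffunE ge_min lexx orbT.
Qed.

End Configurations.

(** * Histories following a strategy *)

Section Plays.
Local Open Scope ring_scope.
Variable G : game.
Variable sigma : seq (state G) -> state G.
Notation S := (state G).
Implicit Types (h : seq S) (t : S).

Inductive follows : seq S -> Prop :=
| follows_init : follows [:: init G]
| follows_rcons h t : follows h -> edge (last (init G) h) t ->
    (last (init G) h \in P1 G -> t = sigma h) -> follows (rcons h t).

Lemma follows_cons h : follows h -> exists h', h = init G :: h'.
Proof.
elim=> [|h' t _ [g ->] _ _]; first by exists [::].
by exists (rcons g t); rewrite rcons_cons.
Qed.

Lemma follows_take h i : follows h -> (0 < i)%N -> follows (take i h).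
Proof.
move=> fh i0; elim: fh i i0 => [|h' t fh IH ed st] i i0.
  by case: i i0 => // i _; exact: follows_init.
have [le|lt] := leqP (size (rcons h' t)) i.
  by rewrite take_oversize //; exact: follows_rcons.
have ih : (i <= size h')%N by rewrite -ltnS -(size_rcons h' t).
by rewrite -cats1 takel_cat //; exact: IH.
Qed.

End Plays.

(** * The controller and its virtual energy *)

Section Virtual.
Local Open Scope ring_scope.
Variable G : game.
Notation S := (state G).
Notation k := (gdim G).
Notation W := (max_weight G).
Notation rho := (W * #|S|)%N.
Notation V := (dirs G).
Notation slk := (slack V (qcoef G)).
Hypothesis W0 : (0 < W)%N.
Hypothesis not_lose : ~ lose V [::] (init G).

Definition conf0 : conf G := Conf [::] (init G) 0 [::] [::].

Lemma inv_conf0 : inv conf0.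
Proof.
split=> //=; last by move=> i; rewrite ffunE.
split=> // [|a]; first by case.
rewrite in_nil; apply/esym/negbTE; rewrite negb_and.
have [aN|//] := boolP (a \in normals G); rewrite /= -leNgt.
case/normalsP: aN => /nonnegP a0 an0 _.
have [i ai] : exists i, a i != 0.
  apply/existsP; apply: contraNT an0; rewrite negb_exists => /forallP h.
  by apply/eqP/ffunP => i; rewrite ffunE; apply/eqP; rewrite -[_ == _]negbK.
rewrite /slack dot0r add0r (big_rem _ (unitv_dirs i)) /= dot_unitv mulrDr.
apply: (@le_trans _ _ (qcoef G)%:Z); first by rewrite lez_nat leq_addl.
apply: (@le_trans _ _ ((qcoef G)%:Z * `|a i|)).
  by rewrite ler_peMr //; move: ai; clear; lia.
by rewrite lerDl mulr_ge0 // sumr_ge0.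
Qed.

Lemma inv_announceable (c : conf G) : inv c -> announceable V (cA c).
Proof.
move=> ic; apply/andP; split.
  by apply/allP => a /(ctl_normals (inv_ctl ic)) /normals_nonneg.
by apply/allP => a aA; apply/allP => b bA; apply: (ctl_compat (inv_ctl ic)).
Qed.

Lemma illegal (c : conf G) t : edge (cs c) t -> ~ legal c t ->
  bad_move V (cp c) (cs c) (cA c) t.
Proof.
move=> ed nl; rewrite /bad_move -/(pushed c).
have [tz|tz] := boolP (t \in unzip1 (pushed c)); [left | right]; split=> //.
  by move=> gc; apply: nl; do !split=> //; rewrite tz.
by apply: NNPP => h; apply: nl; do !split=> //; rewrite (negbTE tz).
Qed.

(** The current announcement is one of the labels with which [lose] could be witnessed; since it
    fails, some edge is not bad. *)
Lemma legal_P1 (c : conf G) : inv c -> cs c \in P1 G -> exists t, legal c t.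
Proof.
move=> ic sP; apply: NNPP => h; apply: (inv_lose ic); apply/loseP.
exists (cA c); split; [exact: inv_announceable | | by rewrite sP].
by move=> _ t ed; apply: illegal => // lt; apply: h; exists t.
Qed.

Lemma legal_P2 (c : conf G) t : inv c -> cs c \notin P1 G -> edge (cs c) t ->
  legal c t.
Proof.
move=> ic sP ed; apply: NNPP => h; apply: (inv_lose ic); apply/loseP.
exists (cA c); split; [exact: inv_announceable | by rewrite (negbTE sP) |].
by move=> _; exists t => //; exact: illegal.
Qed.

Definition conf_of (h : seq S) : conf G := foldl (@step G) conf0 (behead h).

Definition controller (h : seq S) : S :=
  epsilon (inhabits (init G)) (legal (conf_of h)).

Notation follows := (follows controller).

Lemma conf_of_rcons h t : follows h -> conf_of (rcons h t) = step (conf_of h) t.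
Proof.
by move=> /follows_cons[h' ->]; rewrite /conf_of /= -cats1 foldl_cat.
Qed.

Lemma cs_step (c : conf G) t : cs (step c t) = t.
Proof. by rewrite /step; case: ifP. Qed.

Lemma follows_inv h : follows h ->
  inv (conf_of h) /\ cs (conf_of h) = last (init G) h.
Proof.
elim=> [|h' t fh [ic e] ed st]; first by split=> //; exact: inv_conf0.
rewrite conf_of_rcons // cs_step last_rcons; split=> //; apply: step_inv => //.
have [sP|sP] := boolP (last (init G) h' \in P1 G).
  by rewrite (st sP); apply: epsilon_spec; apply: legal_P1; rewrite ?e.
by apply: legal_P2; rewrite // e.
Qed.

Lemma controller_edge h : follows h -> last (init G) h \in P1 G ->
  edge (last (init G) h) (controller h).
Proof.
move=> fh; have [ic <-] := follows_inv fh => sP.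
by have [] := epsilon_spec (inhabits (init G)) _ (legal_P1 ic sP).
Qed.

(** The level as the controller sees it: it stays in a box while the true level may grow. *)
Definition energy (c : conf G) : vec k := cx c + eff (cp c) (cs c).

Lemma energy_step (c : conf G) t i :
  energy (step c t) i <= energy c i + weight (cs c) t i.
Proof.
have e : eff (pushed c) t = weight (cs c) t + eff (cp c) (cs c) by [].
rewrite /step; case: ifPn => tz; rewrite /energy /=; last first.
  by rewrite !ffunE [leRHS]addrAC -addrA.
have e2 := eff_cycle tz; rewrite e in e2.
move: e2 => /ffunP/(_ i); rewrite !ffunE => e2.
have : Order.min (cx c i + eff (cycle_of (pushed c) t) t i) (cap G)%:Z <=
    cx c i + eff (cycle_of (pushed c) t) t i by rewrite ge_min lexx.
move: e2; move: (Order.min _ _) => m; move: (cx c i) (weight _ _ i).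
move: (eff (cp c) _ i) => a1; move: (eff (cycle_of _ _) _ i) => a2.
by move: (eff _ _ i) => *; lia.
Qed.

Lemma energy_floor (c : conf G) i : inv c -> - (floor G)%:Z <= energy c i.
Proof.
move=> ic; rewrite /energy ffunE /floor PoszD opprD lerD ?inv_floor //.
have /andP[_ un] := inv_uniq ic.
have := dirs_le W0 i (eff_dirs un (inv_path ic)).
by rewrite ler_norml => /andP[].
Qed.

Lemma energy_ceil (c : conf G) i : inv c -> energy c i <= (cap G + rho)%N%:Z.
Proof.
move=> ic; rewrite /energy ffunE PoszD lerD ?(inv_cap ic) //.
have /andP[_ un] := inv_uniq ic.
have := dirs_le W0 i (eff_dirs un (inv_path ic)).
by rewrite ler_norml => /andP[].
Qed.

(* Only truncation can make the energy differ from the true energy level. *)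
Lemma waste_mono h i j : follows h -> (0 < i <= j)%N -> (j <= size h)%N -> forall x,
  EL (take i h) x - energy (conf_of (take i h)) x <=
  EL (take j h) x - energy (conf_of (take j h)) x.
Proof.
move=> fh /andP[i0 ij] jh x; elim: j ij jh => [|j IH].
  by rewrite leqn0 => /eqP->.
rewrite leq_eqVlt => /predU1P[->//|]; rewrite ltnS => ij jh.
apply: le_trans (IH ij (ltnW jh)) _.
have j0 : (0 < j)%N by apply: leq_trans ij.
have ft := follows_take fh j0.
rewrite (take_nth (init G) jh) conf_of_rcons //.
have [ic e] := follows_inv ft; have [h' eh] := follows_cons ft.
set t := nth _ _ _; have := energy_step (conf_of (take j h)) t x.
rewrite e; move: (energy _ x) (energy _ x) => u w.
rewrite eh rcons_cons EL_rcons /= ffunE.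
by move: (EL _ x) (weight _ _ _) => *; lia.
Qed.

Definition radius := (floor G + cap G + rho)%N.

Definition length_bound := (#|S| * radius.+1 ^ k)%N.

(** State and virtual energy repeat by the pigeonhole principle; as the true level gains on the
    virtual one, the repetition is a covering. *)
Lemma long_covering h : follows h -> (length_bound < size h)%N ->
  exists i j, [/\ (0 < i < j)%N, (j <= size h)%N,
    last (init G) (take i h) = last (init G) (take j h)
  & vle (EL (take i h)) (EL (take j h))].
Proof.
move=> fh long.
pose code (n : 'I_(size h)) : S * {ffun 'I_k -> 'I_radius.+1} :=
  (last (init G) (take n.+1 h),
   [ffun x => inord (absz (energy (conf_of (take n.+1 h)) x + (floor G)%:Z))]).
have : ~~ injectiveb code.
  apply/negP => /injectiveP/leq_card.
  rewrite card_ord card_prod card_ffun !card_ord leqNgt => /negP; apply.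
  exact: long.
move=> /injectivePn[n1 [n2 neq eqc]].
wlog lt : n1 n2 neq eqc / (n1 < n2)%N.
  move=> H; have [lt|lt|e] := ltngtP n1 n2; first exact: (H n1 n2).
    by apply: (H n2 n1) => //; rewrite eq_sym.
  by case/eqP: neq; apply: val_inj.
exists n1.+1, n2.+1; split=> //.
- by case: eqc.
- apply/forallP => x; have wm := @waste_mono h n1.+1 n2.+1 fh _ (ltn_ord n2) x.
  have {wm} := wm (ltnW lt); case: eqc => _ /ffunP/(_ x); rewrite [LHS]ffunE [RHS]ffunE.
  move=> /(congr1 val) /=.
  have [i1 _] := follows_inv (follows_take fh (ltn0Sn n1)).
  have [i2 _] := follows_inv (follows_take fh (ltn0Sn n2)).
  have := energy_floor x i1; have := energy_floor x i2.
  have := energy_ceil x i1; have := energy_ceil x i2.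
  move: (energy _ x) (energy _ x) (EL _ x) (EL _ x) => e1 e2 E1 E2.
  rewrite /radius; move: (floor G) (cap G) rho => f c r b1 b2 b3 b4.
  by rewrite !inordK; lia.
Qed.

End Virtual.

(** * From the covering tree to the DAG *)

Section Dedup.
Variables (T L : eqType) (f : T -> L).

Fixpoint dedup (s : seq T) : seq T :=
  if s is x :: r then
    if f x \in map f (dedup r) then dedup r else x :: dedup r
  else [::].

Lemma dedup_sub s : {subset dedup s <= s}.
Proof.
elim: s => //= x s IH y; case: ifP => _; first by move=> /IH ys; rewrite inE ys orbT.
by rewrite !inE => /orP[->//|/IH ->]; rewrite orbT.
Qed.

Lemma dedup_inj s : {in dedup s &, injective f}.
Proof.
elim: s => //= x s IH; case: ifPn => // nx y z.
rewrite !inE => /predU1P[->|ys] /predU1P[->|zs] // e; last exact: IH.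
  by case/negP: nx; rewrite e map_f.
by case/negP: nx; rewrite -e map_f.
Qed.

Lemma dedup_rep s x : x \in s -> f x \in map f (dedup s).
Proof.
elim: s => //= y s IH; rewrite inE => /predU1P[->|/IH xs].
  by case: ifP => //= _; rewrite mem_head.
by case: ifP => //= _; rewrite inE xs orbT.
Qed.

End Dedup.

Section TreeToDag.
Local Open Scope ring_scope.
Variable G : game.
Variable sigma : seq (state G) -> state G.
Variable N : nat.
Notation S := (state G).
Notation k := (gdim G).
Notation W := (max_weight G).
Notation follows := (follows sigma).
Notation lst := (last (init G)).
Hypothesis sigma_edge : forall h, follows h -> lst h \in P1 G ->
  edge (lst h) (sigma h).
Hypothesis covering : forall h, follows h -> (N < size h)%N ->
  exists i j, [/\ (0 < i < j)%N, (j <= size h)%N,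
    lst (take i h) = lst (take j h) & vle (EL (take i h)) (EL (take j h))].
Implicit Types (h g : seq S) (t : S).

Definition covered h := has (fun i =>
  (lst (take i h) == lst h) && vle (EL (take i h)) (EL h)) (iota 1 (size h).-1).

Definition label h : nat * S * vec k := (size h, lst h, EL h).

Definition children h : seq (seq S) :=
  if lst h \in P1 G then [:: rcons h (sigma h)]
  else [seq rcons h t | t <- enum S & edge (lst h) t].

(** Merged nodes continue with the past of one representative. It is a genuine history following
    [sigma], so the covering bound still applies to it. *)
Fixpoint reps (n : nat) : seq (seq S) :=
  if n is m.+1 then
    dedup label (flatten [seq children h | h <- reps m & ~~ covered h])
  else [:: [:: init G]].

Lemma childrenP h g : follows h -> g \in children h ->
  exists t, [/\ g = rcons h t, edge (lst h) t & lst h \in P1 G -> t = sigma h].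
Proof.
rewrite /children => fh; case: ifP => [sP|sP].
  by rewrite inE => /eqP->; exists (sigma h); split=> //; exact: sigma_edge.
by case/mapP=> t; rewrite mem_filter => /andP[ed _] ->; exists t; split=> //; rewrite sP.
Qed.

Lemma repsS n h : h \in reps n.+1 ->
  exists g, [/\ g \in reps n, ~~ covered g & h \in children g].
Proof.
move=> /= /dedup_sub /flatten_mapP[g]; rewrite mem_filter => /andP[cg gn] hg.
by exists g.
Qed.

Lemma reps_follows n h : h \in reps n -> follows h /\ size h = n.+1.
Proof.
elim: n h => [|n IH] h.
  by rewrite inE => /eqP->; split=> //; exact: follows_init.
case/repsS => g [/IH[fg sg] _ /(childrenP fg)[t [-> ed st]]].
by split; [exact: follows_rcons | rewrite size_rcons sg].
Qed.

Lemma reps_uniq n h g : h \in reps n -> g \in reps n -> label h = label g -> h = g.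
Proof.
case: n => [|n]; first by rewrite !inE => /eqP-> /eqP->.
move=> hn gn; exact: (dedup_inj hn gn).
Qed.

Lemma reps_rep n h g : h \in reps n -> ~~ covered h -> g \in children h ->
  exists2 r, r \in reps n.+1 & label r = label g.
Proof.
move=> hn ch gh; have : g \in flatten [seq children h | h <- reps n & ~~ covered h].
  by apply/flatten_mapP; exists h; rewrite ?mem_filter ?ch.
by move=> /(dedup_rep label) /mapP[r rn e]; exists r.
Qed.

Lemma reps_uncovered n h i : h \in reps n -> (0 < i < size h)%N ->
  ~~ covered (take i h).
Proof.
elim: n h => [|n IH] h; first by rewrite inE => /eqP->; case: i => [|[]].
case/repsS => g [gn cg hg]; have [fg sg] := reps_follows gn.
have [t [-> _ _]] := childrenP fg hg.
rewrite size_rcons ltnS => /andP[i0]; rewrite leq_eqVlt => /predU1P[->|ig].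
  by rewrite -cats1 take_size_cat.
by rewrite -cats1 takel_cat ?(ltnW ig) // IH // i0.
Qed.

Lemma reps_covered n h : h \in reps n -> ~~ covered h -> (n < N)%N.
Proof.
move=> hn ch; have [fh sh] := reps_follows hn; rewrite ltnNge; apply/negP => Nn.
have [|i [j [/andP[i0 ij] jh le1 le2]]] := covering fh; first by rewrite sh ltnS.
have cj : covered (take j h).
  apply/hasP; exists i.
    by rewrite mem_iota i0 size_takel //; move: i0 ij; clear; lia.
  by rewrite (take_takel _ (ltnW ij)) le1 eqxx le2.
move: jh; rewrite leq_eqVlt => /predU1P[e|jh].
  by move: ch; rewrite -(take_size h) -e cj.
have := reps_uncovered hn (_ : 0 < j < size h)%N; rewrite cj jh.
by rewrite (leq_trans _ ij) // => /(_ isT).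
Qed.

Definition all_reps := flatten [seq reps n | n <- iota 0 N.+1].

Lemma all_repsP h : h \in all_reps <-> exists2 n, (n <= N)%N & h \in reps n.
Proof.
split=> [/flatten_mapP[n]|[n nN hn]].
  by rewrite mem_iota => nN hn; exists n.
by apply/flatten_mapP; exists n; rewrite // mem_iota.
Qed.

Definition arc h g := ~~ covered h && has (fun c => label c == label g) (children h).

Lemma init_rep : [:: init G] \in all_reps.
Proof. by apply/all_repsP; exists 0%N; rewrite // mem_head. Qed.

Definition dag : ldag G := @LDag G (seq_sub all_reps) (SeqSub init_rep)
  (fun x y => arc (val x) (val y)) (fun x => (size (val x)).-1)
  (fun x => lst (val x)) (fun x => EL (val x)).

Implicit Types x y : node dag.

Lemma nodeP x : exists n, [/\ (n <= N)%N, val x \in reps n, follows (val x)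
  & size (val x) = n.+1].
Proof.
have [n nN hn] := (all_repsP _).1 (ssvalP x).
by have [fh sh] := reps_follows hn; exists n.
Qed.

Lemma node_rep x g : ~~ covered (val x) -> g \in children (val x) ->
  exists2 y, darc x y & label (val y) = label g.
Proof.
move=> cx gx; have [n [nN hn fh sh]] := nodeP x.
have [r rn e] := reps_rep hn cx gx.
have rN : r \in all_reps by apply/all_repsP; exists n.+1 => //; exact: reps_covered hn cx.
exists (SeqSub rN) => //; rewrite /= /arc cx; apply/hasP; exists g => //.
by rewrite e.
Qed.

Lemma node_inj x y : label (val x) = label (val y) -> x = y.
Proof.
have [n [_ hn _ sn]] := nodeP x; have [m [_ hm _ sm]] := nodeP y => e.
have nm : n = m by case: (e); rewrite sn sm => -[].
by rewrite nm in hn; apply: val_inj; exact: reps_uniq hn hm e.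
Qed.

Lemma darcP x y : darc x y -> ~~ covered (val x) /\ exists t,
  [/\ label (val y) = label (rcons (val x) t), edge (nstate x) t
    & nstate x \in P1 G -> t = sigma (val x)].
Proof.
case/andP=> cx /hasP[g gx /eqP e]; split=> //.
have [n [_ _ fh _]] := nodeP x; have [t [ge ed st]] := childrenP fh gx.
by exists t; rewrite -ge e.
Qed.

Lemma leaf_covered x : leaf x = covered (val x).
Proof.
apply/forallP/idP => [h|cx y]; last by rewrite /darc /= /arc cx.
apply: contraT => cx; have [g gx] : exists g, g \in children (val x).
  rewrite /children; case: ifP => _; first by eexists; exact: mem_head.
  have [t ed] := edge_total (lst (val x)); exists (rcons (val x) t).
  by apply: map_f; rewrite mem_filter ed mem_enum.
by have [y xy _] := node_rep cx gx; have := h y; rewrite xy.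
Qed.

(** Representatives are closed under prefixes, so the covering prefix of a leaf is an actual
    ancestor in the DAG. *)
Lemma connect_take x i : (0 < i <= size (val x))%N ->
  exists2 y, val y = take i (val x) & connect (@darc G dag) y x.
Proof.
have [n [nN hn _ sh]] := nodeP x; rewrite sh.
elim: n x nN hn sh => [|n IH] x nN hn sh.
  by case: i => [|[]] // _; exists x; rewrite // take_oversize ?sh.
case/andP=> i0; rewrite leq_eqVlt => /predU1P[->|].
  by exists x; rewrite // take_oversize ?sh.
rewrite ltnS => ni; have [g [gn cg xg]] := repsS hn.
have gN : g \in all_reps by apply/all_repsP; exists n => //; exact: ltnW.
have [fg sg] := reps_follows gn.
have [y ye yg] := IH (SeqSub gN) (ltnW nN) gn sg (introT andP (conj i0 ni)).
exists y; last first.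
  apply: connect_trans yg (connect1 _); rewrite /= /arc cg.
  by apply/hasP; exists (val x).
have [t [-> _ _]] := childrenP fg xg.
by rewrite ye /= -cats1 takel_cat // sg.
Qed.

Lemma strategy_dag_dag : strategy_dag dag.
Proof.
split=> //=.
- move=> x y /darcP[_ [t [/(congr1 (fun l => l.1.1)) /= -> _ _]]].
  by rewrite size_rcons; have [n [_ _ _ ->]] := nodeP x.
- move=> x xr; have [[|n] [nN hn _ sh]] := nodeP x.
    by case/eqP: xr; apply: val_inj; move: hn; rewrite inE => /eqP.
  have [g [gn cg xg]] := repsS hn.
  have gN : g \in all_reps by apply/all_repsP; exists n => //; exact: ltnW.
  by exists (SeqSub gN); rewrite /arc cg; apply/hasP; exists (val x).
- exact: EL1.
- move=> x y /darcP[_ [t [/[dup] /(congr1 (fun l => l.1.2)) /= -> + ed _]]].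
  move=> /(congr1 snd) /= ->; rewrite last_rcons; split=> //.
  have [n [_ _ /follows_cons[h' e] _]] := nodeP x.
  by rewrite /nstate /= e rcons_cons EL_rcons.
- move=> x; rewrite leaf_covered => cx sP.
  have cE : children (val x) = [:: rcons (val x) (sigma (val x))].
    by rewrite /children ifT.
  have [|y xy ye] := @node_rep x (rcons (val x) (sigma (val x))) cx.
    by rewrite cE mem_head.
  exists y; split=> // y' /darcP[_ [t [ye' _ /(_ sP) te]]].
  by apply: node_inj; rewrite ye ye' te.
- move=> x; rewrite leaf_covered => cx sP t ed.
  have tc : rcons (val x) t \in children (val x).
    rewrite /children ifN //; apply: map_f.
    by rewrite mem_filter mem_enum andbT.
  have [y xy ye] := node_rep cx tc.
  have yt : nstate y = t.
    by move: ye => /(congr1 (fun l => l.1.2)) /= ->; rewrite last_rcons.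
  exists y; split=> // y' [/darcP[_ [t' [ye' _ _]]] yt'].
  apply: node_inj; rewrite ye ye'; congr (label (rcons _ _)).
  by rewrite -yt'; move: ye' => /(congr1 (fun l => l.1.2)) /= ->; rewrite last_rcons.
- move=> x; rewrite leaf_covered => /hasP[i]; rewrite mem_iota.
  move=> /andP[i0 ix] /andP[/eqP sE le].
  have ix' : (i < size (val x))%N.
    by have [n [_ _ _ sh]] := nodeP x; move: ix; rewrite sh add1n.
  have [y ye yx] := @connect_take x i (introT andP (conj i0 (ltnW ix'))).
  exists y; rewrite /energy_ancestor yx /nstate /nenergy /= ye sE le eqxx !andbT.
  apply: contraTneq ix' => yxe; rewrite -leqNgt -yxe ye size_take_min geq_minl.
  by [].
Qed.

Lemma depth_dag : (depth dag <= N)%N.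
Proof.
apply/bigmax_leqP => x _ /=; have [n [nN _ _ ->]] := nodeP x.
exact: nN.
Qed.

Lemma EL_bound h i : follows h -> `|EL h i| <= ((size h).-1 * W)%N%:Z.
Proof.
elim=> [|g t fg IH ed _]; first by rewrite EL1 ffunE.
have [h' e] := follows_cons fg; rewrite size_rcons e rcons_cons EL_rcons ffunE.
rewrite e in IH ed; rewrite /= in IH ed *.
apply: le_trans (ler_normD _ _) _; rewrite mulSn addnC PoszD lerD //.
exact: weight_le.
Qed.

Lemma card_level i : (#|[set x : node dag | level x == i]| <=
  #|S| * (2 * N * W + 1) ^ k)%N.
Proof.
pose code x : S * {ffun 'I_k -> 'I_(2 * N * W).+1} :=
  (lst (val x), [ffun j => inord (absz (EL (val x) j + (N * W)%N%:Z))]).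
have inj : {in [set x : node dag | level x == i] &, injective code}.
  move=> x y; rewrite !inE => /eqP lx /eqP ly [eqs /ffunP eqe].
  apply: node_inj; congr (_, _, _) => //.
    have [n [_ _ _ sx]] := nodeP x; have [m [_ _ _ sy]] := nodeP y.
    by move: lx ly; rewrite /= sx sy /= => -> ->.
  apply/ffunP => j; have := eqe j; rewrite !ffunE => /(congr1 val) /=.
  have [n [nN _ fx sx]] := nodeP x; have [m [mN _ fy sy]] := nodeP y.
  have := EL_bound j fx; have := EL_bound j fy; rewrite sx sy /=.
  have : (n * W <= N * W)%N by rewrite leq_mul2r nN orbT.
  have : (m * W <= N * W)%N by rewrite leq_mul2r mN orbT.
  rewrite -mulnA; move: (N * W)%N (n * W)%N (m * W)%N => a b c.
  move: (EL _ j) (EL _ j) => u v h1 h2 h3 h4.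
  by rewrite !inordK; lia.
rewrite -(card_in_imset inj); apply: leq_trans (max_card _) _.
by rewrite card_prod card_ffun !card_ord addn1.
Qed.

Lemma width_dag : (width dag <= #|S| * (2 * N * W + 1) ^ k)%N.
Proof. by apply/bigmax_leqP => i _; exact: card_level. Qed.

End TreeToDag.

(** * The finite-memory strategy described by a DAG *)

Section DagStrategy.
Local Open Scope ring_scope.
Variable G : game.
Variable D : ldag G.
Hypothesis HD : strategy_dag D.
Notation S := (state G).
Implicit Types (x y z : node D) (h : seq S) (s t : S).

Lemma vle_refl k (u : vec k) : vle u u.
Proof. by apply/forallP => i. Qed.

Lemma energy_ancestor_nleaf x y : energy_ancestor x y -> ~~ leaf y.
Proof.
case/and4P=> yx /connectP[[|z p] /= py xe] _ _; first by rewrite xe eqxx in yx.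
by apply/negP => /forallP/(_ z); case/andP: py => ->.
Qed.

(** A proper ancestor has an outgoing arc, so a single jump leads off the leaves. *)
Lemma settleP y : [/\ ~~ leaf (settle y), nstate (settle y) = nstate y
  & vle (nenergy (settle y)) (nenergy y)].
Proof.
rewrite /settle; case: ifPn => [ly|ly]; last by split=> //; exact: vle_refl.
rewrite /oldest_energy_ancestor; case: pickP => [z zy|none]; last first.
  by have [z zy] := leaf_ancestor HD ly; rewrite none in zy.
case: arg_minnP => // w wy _; split; first exact: energy_ancestor_nleaf wy.
  by case/and4P: wy => _ _ /eqP.
by case/and4P: wy.
Qed.

Lemma darc_nleaf x y : darc x y -> ~~ leaf x.
Proof. by move=> xy; apply/negP => /forallP/(_ y); rewrite xy. Qed.

Lemma darc_inj x y z : darc x y -> darc x z -> nstate y = nstate z -> y = z.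
Proof.
move=> xy xz e; have xl := darc_nleaf xy.
have [sP|sP] := boolP (nstate x \in P1 G).
  by have [w [_ wu]] := child_P1 HD xl sP; rewrite -(wu y xy) -(wu z xz).
have [ed _] := darc_label HD xy.
have [w [_ wu]] := child_P2 HD xl sP ed.
by rewrite -(wu y (conj xy erefl)) -(wu z (conj xz (esym e))).
Qed.

Definition successor s : S := odflt s [pick t | edge s t].

Lemma successorP s : edge s (successor s).
Proof.
rewrite /successor; case: pickP => //= none.
by have [t st] := edge_total s; rewrite none in st.
Qed.

(** [None] is the memory before the initial state is read; a state matching no child leaves the
    pebble in place. *)
Definition update_node (m : option (node D)) s : option (node D) :=
  if m is Some x then
    if [pick y | darc x y && (nstate y == s)] is Some y then Some (settle y)
    else Some x
  else Some (settle (droot D)).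

(** The machine moves from the memory preceding [s], hence the update first; [successor] keeps the
    move legal on prefixes without a pebble. *)
Definition next_state (m : option (node D)) s : S :=
  let x := odflt (droot D) (update_node m s) in
  if [pick y | darc x y && edge s (nstate y)] is Some y then nstate y
  else successor s.

Definition dag_moore : moore G :=
  @Moore G (option (node D)) None update_node next_state.

Definition dag_strategy : strategy G := fun h =>
  next_state (foldl update_node None (take (size h).-1 h)) (last (init G) h).

Lemma dag_strategy_rcons h s :
  dag_strategy (rcons h s) = next_state (foldl update_node None h) s.
Proof. by rewrite /dag_strategy size_rcons last_rcons -cats1 take_size_cat. Qed.

Lemma dag_strategy_valid : is_strategy dag_strategy.
Proof.
move=> h s _ _; rewrite dag_strategy_rcons /next_state.
by case: pickP => [y /andP[]|_] //; exact: successorP.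
Qed.

Lemma dag_encodes : encodes dag_moore dag_strategy.
Proof. by move=> h s _ _; rewrite dag_strategy_rcons. Qed.

Lemma pebble_memory h x : pebble h x ->
  [/\ foldl update_node None h = Some x, last (init G) h = nstate x & ~~ leaf x].
Proof.
elim=> [|h' {}x y _ [mx sx lx] xy].
  by have [l1 -> _] := settleP (droot D); rewrite (root_state HD).
rewrite -cats1 foldl_cat mx /= last_cat /=.
have [l1 -> _] := settleP y; split=> //.
case: pickP => [z /andP[xz /eqP e]|/(_ y)]; last by rewrite xy eqxx.
by rewrite (darc_inj xz xy e).
Qed.

Lemma pebble_rcons h x : pebble h x -> exists h' s, h = rcons h' s.
Proof. by case=> [|h' {}x y _ _]; [exists [::], (init G) | exists h', (nstate y)]. Qed.

Lemma dag_described : described_by D dag_strategy.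
Proof.
move=> h x px sP; have [mx sx lx] := pebble_memory px.
have [h' [s e]] := pebble_rcons px.
have ms : update_node (foldl update_node None h') s = Some x.
  by rewrite -mx e -cats1 foldl_cat.
have es : s = nstate x by rewrite -sx e last_rcons.
rewrite e dag_strategy_rcons /next_state ms /=.
case: pickP => [y /andP[xy _]|none]; first by exists y.
have [y [xy _]] := child_P1 HD lx sP.
by have := none y; rewrite xy es; have [-> _] := darc_label HD xy.
Qed.

(** Arcs add the true weight and jumps only lower the node energy, so it remains a lower bound of
    the true level. *)
Lemma pebble_play (p : nat -> S) n : is_play p -> consistent dag_strategy p ->
  exists x, [/\ pebble (play_prefix p n) x, nstate x = p n
    & vle (nenergy x) (EL (play_prefix p n))].
Proof.
move=> [p0 pe] pc; elim: n => [|n [x [px sx ex]]].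
  have -> : play_prefix p 0 = [:: init G] by rewrite /play_prefix /mkseq /= p0.
  exists (settle (droot D)); have [_ se e] := settleP (droot D).
  split.
  - exact: pebble_root.
  - by rewrite se (root_state HD) p0.
  - by rewrite EL1 -(root_energy HD).
have [y xy ys] : exists2 y, darc x y & nstate y = p n.+1.
  have [_ _ lx] := pebble_memory px.
  have [sP|sP] := boolP (p n \in P1 G).
    have [|y xy e] := dag_described px; first by rewrite sx.
    by exists y => //; rewrite (pc n sP) e.
  have sP' : nstate x \notin P1 G by rewrite sx.
  have ed : edge (nstate x) (p n.+1) by rewrite sx.
  by have [y [[xy ys] _]] := child_P2 HD lx sP' ed; exists y.
have hE : play_prefix p n.+1 = rcons (play_prefix p n) (nstate y).
  by rewrite /play_prefix mkseqS ys.
have [l1 s1 e1] := settleP y.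
exists (settle y); rewrite s1; split=> //.
  by rewrite hE; exact: (pebble_step px xy).
have [_ ey] := darc_label HD xy.
apply/forallP => i; apply: le_trans (forallP e1 i) _; rewrite ey ffunE.
have [h' eh] : exists h', play_prefix p n = p 0 :: h' by eexists.
have [_ lh _] := pebble_memory px.
rewrite hE eh rcons_cons EL_rcons ffunE -eh lerD ?(forallP ex) //.
by rewrite -lh eh.
Qed.

Lemma dag_winning : winning dag_strategy.
Proof.
(* The sum over all nodes outweighs the energy of whichever node carries the pebble. *)
exists (fun i => \sum_(x : node D) absz (nenergy x i))%N => p pp pc n i.
have [x [_ _ /forallP/(_ i) ex]] := pebble_play n pp pc.
apply: le_trans (_ : (\sum_(y : node D) absz (nenergy y i))%N%:Z + nenergy x i <= _).
  rewrite (bigD1 x) //= PoszD; move: (\sum_(_ | _) _)%N (nenergy x i) => a b; lia.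
by rewrite lerD2l.
Qed.

Lemma card_node : (#|node D| <= (depth D).+1 * width D)%N.
Proof.
have lev x : (level x < (depth D).+1)%N by rewrite ltnS; exact: leq_bigmax.
have -> : #|node D| = (\sum_(i < (depth D).+1) #|[set x : node D | level x == i]|)%N.
  rewrite -sum1_card (partition_big (fun x => Ordinal (lev x)) predT) //=.
  apply: eq_bigr => i _; rewrite -sum1_card; apply: eq_bigl => x.
  by rewrite inE -val_eqE.
apply: leq_trans (_ : \sum_(i < (depth D).+1) width D <= _)%N.
  apply: leq_sum => i _; exact: (leq_bigmax (F := fun i : 'I_(depth D).+1 =>
    #|[set x : node D | level x == i]|)).
by rewrite sum_nat_const card_ord.
Qed.

End DagStrategy.

(** * Numerical bounds *)

Lemma nat_sqrt n : exists r, r ^ 2 <= n < r.+1 ^ 2.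
Proof.
elim: n => [|n [r /andP[rn nr]]]; first by exists 0.
have [lt|ge] := ltnP n.+1 (r.+1 ^ 2); first by exists r; rewrite (leqW rn).
by exists r.+1; rewrite ge (leq_ltn_trans nr) // ltn_exp2r.
Qed.

(* Taking the minimum avoids a factor [log k] in the exponent. *)
Lemma expn_minn_le k rho : 0 < rho ->
  (2 * (k * rho)).+1 ^ minn k (rho ^ 2) <= rho.+1 ^ (6 * k).
Proof.
move=> r0; have [le|lt] := leqP k (rho ^ 4).
  rewrite expnM; apply: (@leq_trans ((rho.+1 ^ 6) ^ minn k (rho ^ 2))); last first.
    by rewrite leq_pexp2l ?expn_gt0 // geq_minl.
  have [->|k0] := posnP k; first by rewrite min0n.
  have m0 : 0 < minn k (rho ^ 2) by rewrite leq_min k0 expn_gt0 r0.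
  rewrite leq_exp2r //; apply: (@leq_trans (2 * rho ^ 5).+1).
    by rewrite ltnS leq_mul2l /= (expnSr _ 4) leq_mul2r le orbT.
  by move: r0; clear; rewrite !expnS expn0 muln1; nia.
(* With [r] the integer square root of [k], the exponent is at most [r] and the base at most
   [(r + 1) ^ 4 <= 2 ^ (4 * r)], which gives [2 ^ (4 * k)]. *)
have [r /andP[rk kr]] := nat_sqrt k.
have rr : rho ^ 2 <= r.
  rewrite -ltnS -(@ltn_exp2r _ _ 2) // -expnM; exact: ltn_trans kr.
have rho_r : rho <= r by apply: leq_trans rr; rewrite -mulnn leq_pmull.
apply: (@leq_trans ((2 ^ (4 * r)) ^ r)).
  apply: (@leq_trans ((2 * (k * rho)).+1 ^ r)).
    by rewrite leq_pexp2l // geq_min rr orbT.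
  have [->//|r1] := posnP r; rewrite leq_exp2r //.
  apply: (@leq_trans (r.+1 ^ 4)); last first.
    by rewrite mulnC expnM leq_exp2r // ltn_expl.
  apply: (@leq_trans (2 * (r * (r + 2) * r)).+1).
    rewrite ltnS leq_mul2l /= leq_mul //; move: kr; clear.
    by rewrite !expnS expn0 muln1; nia.
  by rewrite !expnS expn0 muln1; clear; nia.
rewrite -expnM -mulnA mulnn; apply: (@leq_trans (2 ^ (6 * k))).
  by rewrite leq_pexp2l // leq_mul.
by have [->|k0] := posnP k; rewrite ?muln0 // leq_exp2r // muln_gt0.
Qed.

Section Bounds.
Variables (y k : nat).
Hypotheses (y1 : 1 < y) (k0 : 0 < k).

(** Products add exponents, and a sum costs one more because [2 <= y ^ k]. *)
Definition pow_le e a := a <= y ^ (e * k).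

Lemma pow_le_mono e f a : e <= f -> pow_le e a -> pow_le f a.
Proof.
move=> ef ae; apply: leq_trans ae _.
by rewrite leq_pexp2l ?(ltnW y1) // leq_mul2r ef orbT.
Qed.

Lemma pow_le_base e a : 0 < e -> a <= y -> pow_le e a.
Proof.
move=> e0 ay; apply: leq_trans ay _; rewrite -{1}(expn1 y).
by rewrite leq_pexp2l ?(ltnW y1) // muln_gt0 e0.
Qed.

Lemma pow_leM e f a b : pow_le e a -> pow_le f b -> pow_le (e + f) (a * b).
Proof. by move=> ae bf; rewrite /pow_le mulnDl expnD leq_mul. Qed.

Lemma pow_leD e f a b : pow_le e a -> pow_le f b -> pow_le (maxn e f).+1 (a + b).
Proof.
move=> /(pow_le_mono (leq_maxl e f)) ae /(pow_le_mono (leq_maxr e f)) bf.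
rewrite /pow_le mulSn expnD; apply: leq_trans (leq_add ae bf) _.
rewrite addnn -mul2n leq_mul2r; apply/orP; right.
apply: leq_trans y1 _; rewrite -{1}(expn1 y).
by rewrite leq_pexp2l ?(ltnW y1).
Qed.

Lemma pow_le1 : pow_le 0 1.
Proof. by []. Qed.

Lemma pow_leS e a : pow_le e a -> pow_le e.+1 a.+1.
Proof. by move=> ae; have := pow_leD pow_le1 ae; rewrite max0n add1n. Qed.

End Bounds.

(** * Bounds on the constants of the controller *)

Section GameBounds.
Variable G : game.
Notation S := (state G).
Notation k := (gdim G).
Notation W := (max_weight G).
Notation rho := (W * #|S|)%N.
Notation y := (rho + 1).
Hypothesis W0 : (0 < W)%N.

Lemma base_gt1 : 1 < y.
Proof. by rewrite addn1 ltnS rho_gt0. Qed.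

Local Notation ple := (pow_le y k).
Let k0 := gdim_gt0 W0.
Let y1 := base_gt1.
Let D := pow_leD y1 k0.

Lemma radius_le : ple 43 (radius G).+1.
Proof.
have pk : ple 1 k.
  rewrite /pow_le mul1n; apply: ltnW; apply: leq_trans (ltn_expl k (ltnSn 1)) _.
  by rewrite leq_exp2r // gdim_gt0.
have pr : ple 1 rho by apply: pow_le_base; rewrite ?leq_addr ?gdim_gt0 ?base_gt1.
have ps : ple 1 #|S|.
  apply: pow_le_base; rewrite ?gdim_gt0 ?base_gt1 //.
  by apply: leq_trans (leq_addr _ _); rewrite leq_pmull.
have pV : ple 2 (size (dirs G)).
  apply: leq_trans (size_dirs W0) _.
  rewrite expnM leq_exp2r ?gdim_gt0 //.
  by clear; rewrite !expnS expn0 muln1; nia.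
(* Since [#|S| <= rho], the minimum with [#|S| ^ 2] is at most the one with [rho ^ 2]. *)
have pB : ple 6 (dir_bound G).
  rewrite /pow_le addn1; apply: leq_trans (expn_minn_le _ (rho_gt0 W0)).
  rewrite leq_pexp2l // leq_min geq_minl /= geq_min leq_exp2r // leq_pmull ?orbT //.
have pd : ple 8 (dot_bound G) := pow_leM pk (pow_leM pB pr).
have pp : ple 6 (phi_bound G) := D (pow_leM (pow_leS y1 k0 pV) pV) pV.
have pt : ple 17 (theta G) :=
  pow_leM pd (D (pow_le1 y k) (pow_leM ps (D (pow_le1 y k) pp))).
have pq : ple 28 (qcoef G) := D (pow_leM pd (pow_leM pV pt)) pt.
have pf : ple 32 (floor G) := D (pow_leM pq (pow_leM pV pr)) pr.
have pc : ple 40 (cap G) := D (pow_leM pk (pow_leM pB pf)) pt.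
exact: pow_leS (D (D pf pc) pr).
Qed.

(** The power [k] turns the exponent [43 * k] of the radius into [43 * k ^ 2]; the factor [#|S|] and
    the two successors cost [k ^ 2] each. *)
Lemma length_bound_le : (length_bound G).+2 <= y ^ (46 * k ^ 2).
Proof.
have kk := gdim_gt0 W0; have yy := base_gt1.
have le : length_bound G <= y ^ (44 * k ^ 2).
  rewrite mulSn expnD leq_mul //.
    apply: (@leq_trans y); first by apply: leq_trans (leq_addr _ _); rewrite leq_pmull.
    by rewrite -{1}(expn1 y) leq_pexp2l ?(ltnW yy) // expn_gt0 kk.
  by rewrite -mulnn mulnA expnM leq_exp2r //; exact: radius_le.
have k2 : 0 < k ^ 2 by rewrite expn_gt0 kk.
have pw : pow_le y (k ^ 2) 44 (length_bound G) by [].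
have : pow_le y (k ^ 2) 46 _ := pow_leS yy k2 (pow_leS yy k2 pw).
exact.
Qed.

End GameBounds.

Theorem lemma5 :
  exists c : nat, forall G : game,
    let W := max_weight G in
    let d := branching G in
    let k := gdim G in
    let l := 2 ^ ((d - 1) * #|state G|) * (W * #|state G| + 1) ^ (c * k ^ 2) in
    let L := #|state G| * (2 * l * W + 1) ^ k in
    0 < W ->
    (exists sigma : strategy G,
        [/\ is_strategy sigma, finite_memory sigma & winning sigma]) ->
    exists D : ldag G,
      [/\ strategy_dag D, depth D <= l, width D <= L
        & exists sigma : strategy G,
            [/\ is_strategy sigma, described_by D sigma, winning sigma
              & exists M : moore G, encodes M sigma /\ #|memory M| <= l * L]].
Proof.
exists 46 => G W d k l L W0 [sigma [st _ win]].
have nl : ~ lose (dirs G) [::] (init G).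
  by apply: winning_not_lose st win => c s; exact: eff_dirs.
have ce := controller_edge W0 nl; have cov := long_covering W0 nl.
(* One unit is for the number of levels, which exceeds the depth by one, the other for the memory
   state [None]. *)
have Nl : (length_bound G).+2 <= l.
  by apply: leq_trans (length_bound_le W0) _; rewrite leq_pmull // expn_gt0.
pose D := dag (@controller G) (length_bound G).
have HD : strategy_dag D := strategy_dag_dag ce cov.
have dD : depth D <= length_bound G := depth_dag (length_bound G) ce.
have wD : width D <= #|state G| * (2 * length_bound G * W + 1) ^ k
  := width_dag (length_bound G) ce.
have kk : 0 < k := gdim_gt0 W0.
have wL : width D <= L.
  apply: leq_trans wD _; rewrite leq_mul2l leq_exp2r // leq_add2r leq_mul2r.
  by rewrite leq_mul2l (ltnW (ltnW Nl)) !orbT.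
exists D; split=> //; first by apply: leq_trans dD _; exact: (ltnW (ltnW Nl)).
exists (dag_strategy D); split.
- exact: dag_strategy_valid.
- exact: dag_described.
- exact: dag_winning.
exists (dag_moore D); split; first exact: dag_encodes.
rewrite card_option; apply: leq_ltn_trans (card_node D) _.
have L0 : 0 < L by rewrite muln_gt0 card_state_gt0 expn_gt0 addn1.
apply: (@leq_trans ((length_bound G).+2 * L)); last by rewrite leq_mul2r Nl orbT.
by rewrite [leqRHS]mulSn -add1n leq_add // leq_mul.
Qed.
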